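(* A language over $A$ is definable both by a $\Sigma_2^+$ formula and by a $\Pi_2^+$ formula if and only if it is monotone and definable in $\mathrm{FO}^2[\mathfrak{B}_<]$.
   Context: Let $\Sigma$ be a finite set of unary predicates and $A=2^\Sigma$. For words $u,v\in A^*$, $u\le_{A^*}v$ iff $|u|=|v|$ and each letter of $u$ is a subset of the corresponding letter of $v$; $L$ is monotone if $u\in L$ and $u\le_{A^*}v$ imply $v\in L$. First-order formulas use unary atoms $a(x)$, $a\in\Sigma$ (true iff $a$ belongs to the letter at position $x$), and binary predicates $<,\le,=,\ne$ on positions. $\mathrm{FO}^2[\mathfrak{B}_<]$ is the set of such formulas using only two distinct variable names (reusable). $\Sigma_2$ is the set of formulas of the form $\exists x_1\dots x_n\forall y_1\dots y_m\,\varphi$ with $\varphi$ quantifier-free; $\Pi_2$ is the set of negations of $\Sigma_2$ formulas (equivalently prenex formulas $\forall\dots\exists\dots\varphi$ with quantifier-free $\varphi$). $\Sigma_2^+$ (resp. $\Pi_2^+$) is the set of $\Sigma_2$ (resp. $\Pi_2$) formulas containing no negation.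
   Formalization: Definability of a language by a sentence is required on nonempty words only (models of first-order logic are nonempty); with the empty word evaluated as an empty structure the claim fails, e.g. for the empty word together with all words having a position satisfying a. *)

(* Defs.v *)
From mathcomp Require Import all_boot.

Set Implicit Arguments.
Unset Strict Implicit.
Unset Printing Implicit Defensive.

Section Words.
Variable Sig : finType.

Definition letter := {set Sig}.
Definition word := seq letter.
Definition language := word -> Prop.

(* all2 also requires the two words to have the same length. *)
Definition word_le (u v : word) : bool :=
  all2 (fun a b : letter => a \subset b) u v.

Definition monotone (L : language) : Prop :=
  forall u v : word, L u -> word_le u v -> L v.

End Words.

Inductive binpred := BLt | BLe | BEq | BNe.

Definition binpred_sem (b : binpred) (i j : nat) : bool :=
  match b with
  | BLt => i < j
  | BLe => i <= j
  | BEq => i == j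
  | BNe => i != j
  end.

(* Variables are named (by natural numbers) rather than de Bruijn indices, so
   that names can be counted and reused. There is no implication connective,
   hence negation occurs in a formula exactly when FNot does. *)
Inductive formula (Sig : finType) : Type :=
  | FTrue
  | FFalse
  | FLetter of Sig & nat
  | FBin of binpred & nat & nat
  | FNot of formula Sig
  | FAnd of formula Sig & formula Sig
  | FOr of formula Sig & formula Sig
  | FEx of nat & formula Sig
  | FAll of nat & formula Sig.

Arguments FTrue {Sig}.
Arguments FFalse {Sig}.
Arguments FBin {Sig}.

Section Formulas.
Variable Sig : finType.
Implicit Types (phi psi : formula Sig) (w : word Sig) (e : nat -> nat).

Definition update e (x i : nat) : nat -> nat :=
  fun y => if y == x then i else e y.

Fixpoint sat w e phi : bool :=
  match phi with
  | FTrue => true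
  | FFalse => false
  | FLetter a x => a \in nth set0 w (e x)
  | FBin b x y => binpred_sem b (e x) (e y)
  | FNot p => ~~ sat w e p
  | FAnd p q => sat w e p && sat w e q
  | FOr p q => sat w e p || sat w e q
  | FEx x p => [exists i : 'I_(size w), sat w (update e x i) p]
  | FAll x p => [forall i : 'I_(size w), sat w (update e x i) p]
  end.

Fixpoint free_vars phi : seq nat :=
  match phi with
  | FTrue | FFalse => [::]
  | FLetter _ x => [:: x]
  | FBin _ x y => [:: x; y]
  | FNot p => free_vars p
  | FAnd p q | FOr p q => free_vars p ++ free_vars q
  | FEx x p | FAll x p => [seq y <- free_vars p | y != x]
  end.

Definition sentence phi : bool := free_vars phi == [::].

Fixpoint var_names phi : seq nat :=
  match phi with
  | FTrue | FFalse => [::]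
  | FLetter _ x => [:: x]
  | FBin _ x y => [:: x; y]
  | FNot p => var_names p
  | FAnd p q | FOr p q => var_names p ++ var_names q
  | FEx x p | FAll x p => x :: var_names p
  end.

Fixpoint quantifier_free phi : bool :=
  match phi with
  | FTrue | FFalse | FLetter _ _ | FBin _ _ _ => true
  | FNot p => quantifier_free p
  | FAnd p q | FOr p q => quantifier_free p && quantifier_free q
  | FEx _ _ | FAll _ _ => false
  end.

Fixpoint negation_free phi : bool :=
  match phi with
  | FTrue | FFalse | FLetter _ _ | FBin _ _ _ => true
  | FNot _ => false
  | FAnd p q | FOr p q => negation_free p && negation_free q
  | FEx _ p | FAll _ p => negation_free p
  end.

Definition FExs (xs : seq nat) phi : formula Sig := foldr (@FEx Sig) phi xs.
Definition FAlls (xs : seq nat) phi : formula Sig := foldr (@FAll Sig) phi xs.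

Definition FO2 phi : Prop := size (undup (var_names phi)) <= 2.

Definition Sigma2 phi : Prop :=
  exists (xs ys : seq nat) psi,
    quantifier_free psi /\ phi = FExs xs (FAlls ys psi).

Definition Pi2 phi : Prop :=
  exists (xs ys : seq nat) psi,
    quantifier_free psi /\ phi = FAlls xs (FExs ys psi).

Definition Sigma2_pos phi : Prop := Sigma2 phi /\ negation_free phi.
Definition Pi2_pos phi : Prop := Pi2 phi /\ negation_free phi.

(* The initial valuation is irrelevant when phi is a sentence. *)
Definition models w phi : bool := sat w (fun=> 0) phi.

(* Models of first-order logic are nonempty, so a sentence says nothing about
   the empty word. This matters for prenex classes: on the empty structure every
   formula starting with an existential quantifier is false, so that e.g. the
   language [::] + (words with a position satisfying a), which is monotone and
   defined on all words by the FO2 sentence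
   (forall x, false) \/ (exists x, a(x)), would have no Sigma2 definition if
   the empty word were taken into account. *)
Definition defines phi (L : language Sig) : Prop :=
  forall w, w != [::] -> (L w <-> models w phi).

Definition definable_in (F : formula Sig -> Prop) (L : language Sig) : Prop :=
  exists phi, [/\ F phi, sentence phi & defines phi L].

End Formulas.

(* Main.v *)
Require Import Defs.
From mathcomp Require Import all_boot zify.
From Stdlib Require Import Classical.

Set Implicit Arguments.
Unset Strict Implicit.
Unset Printing Implicit Defensive.

(** Given a two-variable sentence of quantifier depth [k], mark in a word [w] its
    two end positions and, [k] times over, the next and
    the previous occurrence of every letter from each mark. A word [w'] with
    positions corresponding to the marks, such that every position of [w'] has a
    counterpart in [w] with the same letter and the same order relation to the
    marks, is equivalent to [w] (Duplicator always answers with marked positions).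
    Existence of such positions is a Sigma2 condition, and for a monotone language
    letters need only be compared by inclusion, which makes the formula positive.
    The Pi2 formula is obtained dually from the complement.

    Conversely, if [L] and its complement are Sigma2 definable, the syntactic
    congruence has finite index and satisfies [u^N ~ u^N x u^N] whenever all letters
    of [x] occur in [u], i.e. the syntactic monoid is in DA. Then the letter at
    which a prefix leaves its R-class does not occur in the part read within this
    R-class, so by induction on the alphabet the congruence class is determined by
    iterated factorizations at first and last occurrences of letters, and these
    are expressible with two variables by relativization. *)

(** * Prenex formulas, dual formulas and monotonicity of positive formulas *)

Section Semantics.
Variable Sig : finType.
Implicit Types (phi psi : formula Sig) (w : word Sig) (e : nat -> nat).

Lemma sat_ext w phi e e' :
  (forall x, x \in free_vars phi -> e x = e' x) -> sat w e phi = sat w e' phi.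
Proof.
elim: phi e e' => [||a x|b x y|p IH|p IHp q IHq|p IHp q IHq|x p IH|x p IH] e e' H //=.
- by rewrite (H x) //= inE eqxx.
- by rewrite (H x) ?(H y) //= !inE eqxx ?orbT.
- by rewrite (IH e e').
- by rewrite (IHp e e') ?(IHq e e') // => z zp; apply: H; rewrite /= mem_cat zp ?orbT.
- by rewrite (IHp e e') ?(IHq e e') // => z zp; apply: H; rewrite /= mem_cat zp ?orbT.
- apply: eq_existsb => i; apply: IH => z zp; rewrite /update.
  by case: eqVneq => // zx; apply: H; rewrite /= mem_filter zx.
- apply: eq_forallb => i; apply: IH => z zp; rewrite /update.
  by case: eqVneq => // zx; apply: H; rewrite /= mem_filter zx.
Qed.

Lemma sat_FExs w xs phi e :
  sat w e (FExs xs phi) <->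
  exists e', [/\ forall x, x \notin xs -> e' x = e x,
                 forall x, x \in xs -> e' x < size w & sat w e' phi].
Proof.
elim: xs e => [|x xs IH] e /=.
  split=> [H|[e' [H _ He']]]; first by exists e.
  by rewrite (@sat_ext _ _ _ e') // => y _; rewrite H.
split=> [/existsP [i /IH [e' [H1 H2 H3]]]|[e' [H1 H2 H3]]].
  exists e'; split=> // y; rewrite inE.
    by rewrite negb_or => /andP [yx yxs]; rewrite H1 // /update (negbTE yx).
  case: (boolP (y \in xs)) => [/H2 //|yxs]; rewrite orbF => /eqP ->.
  have [/H2 //|xxs] := boolP (x \in xs).
  by rewrite H1 // /update eqxx ltn_ord.
have lx : e' x < size w by apply: H2; rewrite inE eqxx.
apply/existsP; exists (Ordinal lx); apply/IH; exists e'; split=> // y yxs.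
  rewrite /update; case: eqVneq => [-> //|yx].
  by apply: H1; rewrite inE negb_or yx.
by apply: H2; rewrite inE yxs orbT.
Qed.

Lemma sat_FAlls w xs phi e :
  sat w e (FAlls xs phi) = ~~ sat w e (FExs xs (FNot phi)).
Proof.
elim: xs e => [|x xs IH] e /=; first by rewrite negbK.
by rewrite negb_exists; apply: eq_forallb => i; rewrite IH.
Qed.

Lemma free_vars_FExs xs phi :
  free_vars (FExs xs phi) = [seq y <- free_vars phi | y \notin xs].
Proof.
elim: xs => [|x xs IH] /=; first by rewrite filter_predT.
rewrite IH -filter_predI; apply: eq_filter => y /=.
by rewrite inE negb_or.
Qed.

Lemma free_vars_FAlls xs phi :
  free_vars (FAlls xs phi) = [seq y <- free_vars phi | y \notin xs].
Proof.
elim: xs => [|x xs IH] /=; first by rewrite filter_predT.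
rewrite IH -filter_predI; apply: eq_filter => y /=.
by rewrite inE negb_or.
Qed.

Lemma sentence_prenex xs ys psi :
  {subset free_vars psi <= xs ++ ys} -> sentence (FExs xs (FAlls ys psi)).
Proof.
move=> H; rewrite /sentence free_vars_FExs free_vars_FAlls -filter_predI.
apply/eqP; rewrite -(filter_pred0 (free_vars psi)); apply: eq_in_filter => y /H.
by rewrite mem_cat /=; case: (y \in xs); case: (y \in ys).
Qed.

Definition in_range w e := forall x, e x < size w.

(** Both quantifier blocks become choices of total valuations with values in range. Names outside
    the blocks need an arbitrary position, which exists because [w] is nonempty. *)
Lemma models_prenex w xs ys psi :
  w != [::] -> sentence (FExs xs (FAlls ys psi)) ->
  models w (FExs xs (FAlls ys psi)) <->
  exists2 e, in_range w e & forall e', in_range w e' ->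
    (forall x, x \notin ys -> e' x = e x) -> sat w e' psi.
Proof.
move=> wn /eqP S; have w0 : 0 < size w by case: w wn.
split=> [/sat_FExs [e [H1 H2]]|[e er H]].
  rewrite sat_FAlls => H; exists e => [x|e' re' He'].
    by have [/H2 //|/H1 ->] := boolP (x \in xs).
  apply: contraR H => H; apply/sat_FExs; exists e'; split=> //.
rewrite /models (@sat_ext _ _ _ e) ?S //; apply/sat_FExs; exists e; split=> //.
rewrite sat_FAlls; apply/negP => /sat_FExs [e' [H1 H2]] /=; apply/negP.
rewrite negbK; apply: H => // x.
by have [/H2 //|/H1 ->] := boolP (x \in ys).
Qed.

(** The binary predicates are closed under complement, so negations are created only on letters.
    Since [FNot p] is sent to [p] itself, a formula whose letters all occur directly under a
    negation, with no other negation, gets a negation-free dual. *)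
Fixpoint neg phi : formula Sig :=
  match phi with
  | FTrue => FFalse
  | FFalse => FTrue
  | FLetter a x => FNot (FLetter a x)
  | FBin BLt x y => FBin BLe y x
  | FBin BLe x y => FBin BLt y x
  | FBin BEq x y => FBin BNe x y
  | FBin BNe x y => FBin BEq x y
  | FNot p => p
  | FAnd p q => FOr (neg p) (neg q)
  | FOr p q => FAnd (neg p) (neg q)
  | FEx x p => FAll x (neg p)
  | FAll x p => FEx x (neg p)
  end.

Lemma sat_neg w e phi : sat w e (neg phi) = ~~ sat w e phi.
Proof.
elim: phi e => //= [[] x y|p IH|p IHp q IHq|p IHp q IHq|x p IH|x p IH] e /=;
  rewrite -?ltnNge -?leqNgt ?IHp ?IHq ?negb_and ?negb_or //.
- by rewrite negbK.
- by rewrite negbK.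
- by rewrite negb_exists; apply: eq_forallb => i.
- by rewrite negb_forall; apply: eq_existsb => i.
Qed.

Lemma free_vars_neg phi : free_vars (neg phi) =i free_vars phi.
Proof.
elim: phi => //= [[] x y|p IHp q IHq|p IHp q IHq|x p IH|x p IH] z //=;
  rewrite ?mem_cat ?mem_filter ?IHp ?IHq ?IH // !inE orbC //.
Qed.

Lemma sentence_neg phi : sentence (neg phi) = sentence phi.
Proof.
rewrite /sentence -!size_eq0 -!all_pred0.
by apply: eq_all_r; apply: free_vars_neg.
Qed.

Lemma quantifier_free_neg phi :
  quantifier_free phi -> quantifier_free (neg phi).
Proof.
elim: phi => //= [[] //|p IHp q IHq|p IHp q IHq] /andP [/IHp -> /IHq ->] //.
Qed.

Lemma neg_FExs xs phi : neg (FExs xs phi) = FAlls xs (neg phi).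
Proof. by elim: xs => //= x xs ->. Qed.

Lemma neg_FAlls xs phi : neg (FAlls xs phi) = FExs xs (neg phi).
Proof. by elim: xs => //= x xs ->. Qed.

Lemma negation_free_FExs xs phi :
  negation_free (FExs xs phi) = negation_free phi.
Proof. by elim: xs => //=. Qed.

Lemma negation_free_FAlls xs phi :
  negation_free (FAlls xs phi) = negation_free phi.
Proof. by elim: xs => //=. Qed.

Definition big_and (s : seq (formula Sig)) := foldr (@FAnd Sig) FTrue s.
Definition big_or (s : seq (formula Sig)) := foldr (@FOr Sig) FFalse s.

Lemma sat_big_and w e s : sat w e (big_and s) = all (sat w e) s.
Proof. by elim: s => //= p s ->. Qed.

Lemma sat_big_or w e s : sat w e (big_or s) = has (sat w e) s.
Proof. by elim: s => //= p s ->. Qed.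

Lemma quantifier_free_big_and s : quantifier_free (big_and s) = all (@quantifier_free _) s.
Proof. by elim: s => //= p s ->. Qed.

Lemma quantifier_free_big_or s : quantifier_free (big_or s) = all (@quantifier_free _) s.
Proof. by elim: s => //= p s ->. Qed.

Lemma free_vars_big_and s : free_vars (big_and s) = flatten (map (@free_vars _) s).
Proof. by elim: s => //= p s ->. Qed.

Lemma free_vars_big_or s : free_vars (big_or s) = flatten (map (@free_vars _) s).
Proof. by elim: s => //= p s ->. Qed.

Lemma var_names_big_and s : var_names (big_and s) = flatten (map (@var_names _) s).
Proof. by elim: s => //= p s ->. Qed.

Lemma word_leP (u v : word Sig) :
  reflect (size u = size v /\ forall i, nth set0 u i \subset nth set0 v i)
          (word_le u v).
Proof.
rewrite /word_le; elim: u v => [|a u IH] [|b v] /=; try by constructor; case.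
  by constructor; split=> // i; rewrite nth_nil.
apply: (iffP andP) => [[ab /IH [-> H]]|[[suv] H]].
  by split=> // -[].
by split; [apply: (H 0)|apply/IH; split=> // i; apply: (H i.+1)].
Qed.

Lemma sat_monotone u v e phi :
  negation_free phi -> word_le u v -> sat u e phi -> sat v e phi.
Proof.
move=> + /word_leP [suv H]; elim: phi e => //=.
- by move=> a x e _; apply: (subsetP (H _)).
- by move=> p IHp q IHq e /andP [np nq] /andP [/IHp -> // /IHq ->].
- by move=> p IHp q IHq e /andP [np nq] /orP [/IHp -> //|/IHq ->]; rewrite ?orbT.
- move=> x p IH e np /existsP [i /IH-/(_ np) Hi].
  by apply/existsP; exists (cast_ord suv i).
- move=> x p IH e np /forallP Hi; apply/forallP => i; apply: (IH _ np).
  exact: (Hi (cast_ord (esym suv) i)).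
Qed.

End Semantics.

(** * Two-variable equivalence from matching marks *)

Definition same_side (G : seq (nat * nat)) (i i' : nat) :=
  forall g, g \in G -> (g.1 < i) = (g.2 < i') /\ (i < g.1) = (i' < g.2).

(* Between two consecutive marks of level [r], the first and the last
   occurrence of every letter are marks of level [r.+1]. *)
Definition marks_refine (A : eqType) (x0 : A) (w : seq A) (G : nat -> seq (nat * nat)) k :=
  forall r g j, r < k -> g \in G r -> j < size w ->
    (g.1 < j -> exists2 h, h \in G r.+1 &
       g.1 < h.1 <= j /\ nth x0 w h.1 = nth x0 w j) /\
    (j < g.1 -> exists2 h, h \in G r.+1 &
       j <= h.1 < g.1 /\ nth x0 w h.1 = nth x0 w j).

(** A pair in [G r] is a mark of [w] with its partner in [w']. The level [r] is the number of rounds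
    left in the game: the more rounds, the more marks must be respected. *)
Record marked_pair (A : eqType) (x0 : A) (w w' : seq A) (G : nat -> seq (nat * nat)) k : Prop :=
  MarkedPair {
    mp_incl : forall r, {subset G r <= G r.+1};
    mp_mono : forall r g h, r <= k -> g \in G r -> h \in G r -> (g.1 < h.1) = (g.2 < h.2);
    mp_letter : forall r g, r <= k -> g \in G r ->
      [/\ g.1 < size w, g.2 < size w' & nth x0 w g.1 = nth x0 w' g.2];
    mp_first : forall r, (0, 0) \in G r;
    mp_last : forall r, ((size w).-1, (size w').-1) \in G r;
    mp_refine : marks_refine x0 w G k
  }.

Section Game.
Variables (A : eqType) (x0 : A).
Implicit Types (w : seq A) (G : nat -> seq (nat * nat)).

Definition matched w w' G r i i' :=
  [/\ i < size w, i' < size w', nth x0 w i = nth x0 w' i' & same_side (G r) i i'].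

Lemma same_side_mark w w' G k r g :
  marked_pair x0 w w' G k -> r <= k -> g \in G r -> same_side (G r) g.1 g.2.
Proof. by move=> mp rk gG h hG; rewrite !(mp_mono mp rk). Qed.

(** If [j] is a mark of level [r], Duplicator answers with its partner. Otherwise, for [j < i], let
    [g] be the last mark before [j]: the first occurrence after [g] of the letter of [j] is a mark
    [h] of level [r.+1], no mark of level [r] separates it from [j], and [h.1 <= j < i] keeps the
    order with the other pebble. For [i < j] the mirror choice, the last occurrence before the next
    mark, stays to the right of [i]. *)
Lemma game_move w w' G k r i i' j :
  marked_pair x0 w w' G k -> r < k -> matched w w' G r.+1 i i' -> j < size w ->
  exists j', [/\ matched w w' G r j j', (i < j) = (i' < j') & (j < i) = (j' < i')].
Proof.
move=> mp rk [li li' lets ss] lj; have rk' := ltnW rk.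
have [ij|ij|ij] := ltngtP i j; last first.
- exists i'; rewrite -{j lj}ij ?ltnn; split=> //; split=> // g gG.
  by apply: ss; apply: (mp_incl mp).
- have [/hasP [g gG /eqP gj]|nomark] := boolP (has (fun g => g.1 == j) (G r)).
    exists g.2; have [l1 l2 l3] := mp_letter mp rk' gG.
    have [s1 s2] := ss _ (mp_incl mp gG).
    rewrite -s1 -s2 gj -{3}gj; split; [split=> //; rewrite -?gj //|lia|lia].
    exact: same_side_mark mp rk' gG.
  have neq g : g \in G r -> g.1 != j.
    by move=> gG; apply: contra nomark => gj; apply/hasP; exists g.
  pose P p := has (fun g => (g.1 == p) && (p < j)) (G r).
  (* Position 0 is a mark and [j] is not, so a mark precedes [j]. *)
  have exP : exists p, P p.
    exists 0; apply/hasP; exists (0, 0); rewrite ?(mp_first mp) //=.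
    by move: (neq _ (mp_first mp r)) => /=; lia.
  have ubP p : P p -> p <= j by case/hasP => g _ /andP [_ /ltnW].
  case: (ex_maxnP exP ubP) => p /hasP [g gG /andP [/eqP <- gj]] pmax {p exP ubP}.
  have [/(_ gj) [h hG [/andP [h1 h2] h3]] _] := mp_refine mp rk gG lj.
  have [l1 l2 l3] := mp_letter mp rk hG.
  have [s1 s2] := ss _ hG.
  exists h.2; split; [split=> //|by rewrite -s2; lia|by rewrite -s1; lia].
    by rewrite -h3.
  move=> m mG; have mG' := mp_incl mp mG.
  rewrite -(mp_mono mp rk mG' hG) -(mp_mono mp rk hG mG').
  have mj := neq _ mG.
  have pm : m.1 < j -> m.1 <= g.1.
    by move=> lm; apply: pmax; apply/hasP; exists m; rewrite ?eqxx.
  split; apply/idP/idP; lia.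
- have [/hasP [g gG /eqP gj]|nomark] := boolP (has (fun g => g.1 == j) (G r)).
    exists g.2; have [l1 l2 l3] := mp_letter mp rk' gG.
    have [s1 s2] := ss _ (mp_incl mp gG).
    rewrite -s1 -s2 gj -{3}gj; split; [split=> //; rewrite -?gj //|lia|lia].
    exact: same_side_mark mp rk' gG.
  have neq g : g \in G r -> g.1 != j.
    by move=> gG; apply: contra nomark => gj; apply/hasP; exists g.
  pose P p := has (fun g => (g.1 == p) && (j < p)) (G r).
  have exP : exists p, P p.
    exists (size w).-1; apply/hasP.
    exists ((size w).-1, (size w').-1); rewrite ?(mp_last mp) //=.
    by move: (neq _ (mp_last mp r)) => /=; lia.
  case: (ex_minnP exP) => p /hasP [g gG /andP [/eqP <- gj]] pmin {p exP}.
  have [_ /(_ gj) [h hG [/andP [h1 h2] h3]]] := mp_refine mp rk gG lj.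
  have [l1 l2 l3] := mp_letter mp rk hG.
  have [s1 s2] := ss _ hG.
  exists h.2; split; [split=> //|by rewrite -s2; lia|by rewrite -s1; lia].
    by rewrite -h3.
  move=> m mG; have mG' := mp_incl mp mG.
  rewrite -(mp_mono mp rk mG' hG) -(mp_mono mp rk hG mG').
  have mj := neq _ mG.
  have pm : j < m.1 -> g.1 <= m.1.
    by move=> lm; apply: pmin; apply/hasP; exists m; rewrite ?eqxx.
  split; apply/idP/idP; lia.
Qed.

Definition swap_marks G : nat -> seq (nat * nat) :=
  fun r => [seq (g.2, g.1) | g <- G r].

Lemma mem_swap_marks G r g : (g \in swap_marks G r) = ((g.2, g.1) \in G r).
Proof.
by case: g => p q; apply/mapP/idP => [[[a b] H [-> ->]] //|H]; exists (q, p).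
Qed.

Lemma matched_swap w w' G r i i' :
  matched w w' G r i i' <-> matched w' w (swap_marks G) r i' i.
Proof.
split=> -[h1 h2 h3 h4]; split=> // g.
  by rewrite mem_swap_marks => /h4 [].
by move=> gG; have [] := h4 (g.2, g.1); rewrite // mem_swap_marks /= -surjective_pairing.
Qed.

Lemma marked_pair_swap w w' G k :
  marked_pair x0 w w' G k -> marks_refine x0 w' (swap_marks G) k ->
  marked_pair x0 w' w (swap_marks G) k.
Proof.
move=> mp mr; split=> //.
- by move=> r g; rewrite !mem_swap_marks; apply: (mp_incl mp).
- by move=> r g h rk; rewrite !mem_swap_marks => gG hG; rewrite (mp_mono mp rk gG hG).
- by move=> r g rk; rewrite mem_swap_marks => /(mp_letter mp rk) [].
- by move=> r; rewrite mem_swap_marks (mp_first mp).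
- by move=> r; rewrite mem_swap_marks (mp_last mp).
Qed.

End Game.

Section GameFormula.
Variable Sig : finType.
Implicit Types (phi : formula Sig) (w : word Sig).

Fixpoint qdepth phi : nat :=
  match phi with
  | FTrue | FFalse | FLetter _ _ | FBin _ _ _ => 0
  | FNot p => qdepth p
  | FAnd p q | FOr p q => maxn (qdepth p) (qdepth q)
  | FEx _ p | FAll _ p => (qdepth p).+1
  end.

Variables (w w' : word Sig) (G : nat -> seq (nat * nat)) (k x y : nat).
Hypothesis mp : marked_pair set0 w w' G k.
Hypothesis mr : marks_refine set0 w' (swap_marks G) k.

Definition matched_env r (e e' : nat -> nat) :=
  (forall u, u \in [:: x; y] -> matched set0 w w' G r (e u) (e' u)) /\
  (forall u v, u \in [:: x; y] -> v \in [:: x; y] -> (e u < e v) = (e' u < e' v)).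

(** Quantifying [z] again lifts its pebble, so the new position has to be compared only with the
    pebble [t] that stays. This is where two variables matter. *)
Lemma matched_env_update r e e' z (t := if z == x then y else x) i i' :
  z \in [:: x; y] ->
  matched_env r.+1 e e' -> matched set0 w w' G r i i' ->
  (e t < i) = (e' t < i') -> (i < e t) = (i' < e' t) ->
  matched_env r (update e z i) (update e' z i').
Proof.
rewrite /t => zxy [H1 H2] mi c1 c2.
have tE u : u \in [:: x; y] -> (u == z) = false -> u = if z == x then y else x.
  move: zxy; rewrite !inE; case: (eqVneq z x) => [->|_] /= zy /orP [] /eqP -> //.
    by rewrite eqxx.
  by rewrite eq_sym zy.
split=> [u uxy|u v uxy vxy]; rewrite /update.
  case: eqP => // _; have [h1 h2 h3 h4] := H1 _ uxy; split=> // g gG.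
  by apply: h4; apply: (mp_incl mp).
case: (boolP (u == z)) => [_|/negbTE uz]; case: (boolP (v == z)) => [_|/negbTE vz] //.
- by rewrite !ltnn.
- by rewrite (tE v).
- by rewrite (tE u).
- exact: H2.
Qed.

(** Each quantifier costs one level through [game_move]; a position chosen in [w'] is answered in
    [w] by the same lemma for the swapped marks. *)
Lemma sat_matched phi r e e' :
  {subset var_names phi <= [:: x; y]} -> qdepth phi <= r -> r <= k ->
  matched_env r e e' -> sat w e phi = sat w' e' phi.
Proof.
elim: phi r e e' => [||a u|b u v|p IH|p IHp q IHq|p IHp q IHq|z p IH|z p IH] r e e' sub qd rk me //=.
- have [|_ _ -> _] // := me.1 u; first by apply: sub; rewrite inE.
- have cu : u \in [:: x; y] by apply: sub; rewrite !inE eqxx.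
  have cv : v \in [:: x; y] by apply: sub; rewrite !inE eqxx orbT.
  have := me.2 _ _ cu cv; have := me.2 _ _ cv cu.
  by case: b {sub qd} => /=; lia.
- by rewrite (IH r e e').
- move: qd => /=; rewrite geq_max => /andP [qp qq].
  by rewrite (IHp r e e') ?(IHq r e e') // => z zp; apply: sub; rewrite /= mem_cat zp ?orbT.
- move: qd => /=; rewrite geq_max => /andP [qp qq].
  by rewrite (IHp r e e') ?(IHq r e e') // => z zp; apply: sub; rewrite /= mem_cat zp ?orbT.
- case: r qd rk me => // r qd rk me.
  have sub' : {subset var_names p <= [:: x; y]} by move=> u up; apply: sub; rewrite /= inE up orbT.
  have zxy : z \in [:: x; y] by apply: sub; rewrite /= inE eqxx.
  set t := if z == x then y else x.
  have txy : t \in [:: x; y] by rewrite /t; case: ifP; rewrite !inE eqxx ?orbT.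
  apply/existsP/existsP => -[i si].
    have [i' [m1 c1 c2]] := game_move mp rk (me.1 _ txy) (ltn_ord i).
    have [_ li' _ _] := m1; exists (Ordinal li').
    by rewrite -(IH r (update e z i)) ?(ltnW rk) //; apply: matched_env_update; rewrite -/t ?c1 ?c2.
  have mt := (matched_swap _ _ _ _ _ _ _).1 (me.1 _ txy).
  have [i' [m1 c1 c2]] := game_move (marked_pair_swap mp mr) rk mt (ltn_ord i).
  have {}m1 := (matched_swap _ _ _ _ _ _ _).2 m1; have [li' _ _ _] := m1; exists (Ordinal li').
  by rewrite (IH r _ (update e' z i)) ?(ltnW rk) //; apply: matched_env_update; rewrite -/t ?c1 ?c2.
- case: r qd rk me => // r qd rk me.
  have sub' : {subset var_names p <= [:: x; y]} by move=> u up; apply: sub; rewrite /= inE up orbT.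
  have zxy : z \in [:: x; y] by apply: sub; rewrite /= inE eqxx.
  set t := if z == x then y else x.
  have txy : t \in [:: x; y] by rewrite /t; case: ifP; rewrite !inE eqxx ?orbT.
  apply/forallP/forallP => si i.
    have mt := (matched_swap _ _ _ _ _ _ _).1 (me.1 _ txy).
    have [i' [m1 c1 c2]] := game_move (marked_pair_swap mp mr) rk mt (ltn_ord i).
    have {}m1 := (matched_swap _ _ _ _ _ _ _).2 m1; have [li' _ _ _] := m1.
    by rewrite -(IH r (update e z i')) ?(ltnW rk) //;
       [apply: (si (Ordinal li'))|apply: matched_env_update; rewrite -/t ?c1 ?c2].
  have [i' [m1 c1 c2]] := game_move mp rk (me.1 _ txy) (ltn_ord i).
  have [_ li' _ _] := m1.
  by rewrite (IH r _ (update e' z i')) ?(ltnW rk) //;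
     [apply: (si (Ordinal li'))|apply: matched_env_update; rewrite -/t ?c1 ?c2].
Qed.

End GameFormula.

(** * Marks at next and previous occurrences of letters *)

Section Marks.
Variable (A : finType) (x0 : A).
Implicit Types (w : seq A).

(* [next_pos] and [prev_pos] return the mark [0] when the letter is absent. *)
Definition next_pos w a q :=
  if a \in drop q.+1 w then q.+1 + index a (drop q.+1 w) else 0.

Fixpoint prev_pos w a q :=
  if q is q'.+1 then if nth x0 w q' == a then q' else prev_pos w a q' else 0.

Lemma next_posP w q j : j < size w -> q < j ->
  q < next_pos w (nth x0 w j) q <= j /\
  nth x0 w (next_pos w (nth x0 w j) q) = nth x0 w j.
Proof.
move=> lj qj; rewrite /next_pos; set a := nth x0 w j; set d := drop q.+1 w.
have da : nth x0 d (j - q.+1) = a by rewrite nth_drop subnKC.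
have lsz : j - q.+1 < size d by rewrite size_drop; lia.
have ad : a \in d by rewrite -da mem_nth.
rewrite ad -nth_drop -/d nth_index //; split=> //.
have : index a d <= j - q.+1 by rewrite leqNgt; apply/negP => /(before_find x0) /=; rewrite da eqxx.
lia.
Qed.

Lemma prev_posP w q j : j < q ->
  j <= prev_pos w (nth x0 w j) q < q /\
  nth x0 w (prev_pos w (nth x0 w j) q) = nth x0 w j.
Proof.
elim: q => // q IH; rewrite ltnS => jq /=; case: eqP => [-> |ne].
  by split=> //; rewrite jq leqnn.
have {}jq : j < q by rewrite ltn_neqAle jq andbT; apply/eqP => ej; apply: ne; rewrite ej.
have [/andP [h1 h2] h3] := IH jq.
by split=> //; rewrite h1 ltnS ltnW.
Qed.

Lemma next_pos_range w a q : w != [::] -> next_pos w a q < size w.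
Proof.
move=> wn; rewrite /next_pos; case: ifP => [|_]; last by case: w wn.
by rewrite -index_mem size_drop; set i := index _ _; rewrite ltn_subRL.
Qed.

Lemma prev_pos_range w a q : q < size w -> prev_pos w a q < size w.
Proof.
elim: q => //= q IH lq; case: ifP => _; first exact: ltnW.
by apply: IH; apply: ltnW.
Qed.

(** Repetitions are kept, so the number of marks depends only on [r] and the alphabet; it will be
    the number of existential variables of a formula. The default mark 0 is harmless, being a mark
    of level 0 already. *)
Fixpoint marks w r : seq nat :=
  if r is r'.+1 then
    marks w r' ++ [seq next_pos w a q | q <- marks w r', a <- enum A]
               ++ [seq prev_pos w a q | q <- marks w r', a <- enum A]
  else [:: 0; (size w).-1].

Fixpoint nmarks r := if r is r'.+1 then nmarks r' + (nmarks r' * #|A| + nmarks r' * #|A|) else 2.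

Lemma size_marks w r : size (marks w r) = nmarks r.
Proof. by elim: r => //= r IH; rewrite !size_cat !size_allpairs IH -cardE. Qed.

Lemma marks_range w r q : w != [::] -> q \in marks w r -> q < size w.
Proof.
move=> wn; elim: r q => [|r IH] q /=.
  by case: w wn => // a w _; rewrite !inE /= => /orP [] /eqP ->.
rewrite !mem_cat => /or3P [/IH //|/allpairsP|/allpairsP] [[p a] /= [pm _ ->]].
  exact: next_pos_range.
exact/prev_pos_range/IH.
Qed.

Lemma marks_incl w r s : r <= s -> {subset marks w r <= marks w s}.
Proof.
move/subnK <-; elim: (s - r) => // d IH q /IH H.
by rewrite addSn /= mem_cat H.
Qed.

(** Once the images of the marks are chosen this is a universal condition on [w'], whence the shape
    of a Sigma2 formula. The relation [lrel] is equality in the game and an inclusion of letters in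
    the formulas. *)
Definition mimics (lrel : A -> A -> bool) w w' (Q : seq nat) (f : nat -> nat) :=
  forall y', y' < size w' -> exists y,
    [/\ y < size w, lrel (nth x0 w y) (nth x0 w' y') &
        forall q, q \in Q -> (q < y) = (f q < y') /\ (y < q) = (y' < f q)].

Variables (w w' : seq A) (k : nat) (f : nat -> nat).
Hypotheses (wn : w != [::]) (wn' : w' != [::]).
Hypothesis f_range : forall q, q \in marks w k -> f q < size w'.
Hypothesis mim : mimics (fun a b => a == b) w w' (marks w k) f.

(** Levels are cut at [k] because [f] is controlled only on [marks w k]. *)
Definition mark_graph r := [seq (q, f q) | q <- marks w (minn r k)].

Lemma mark_graphP r g : g \in mark_graph r ->
  [/\ g.1 \in marks w (minn r k), g.1 \in marks w k & g.2 = f g.1].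
Proof.
case/mapP => q qm -> /=; split=> //.
by apply: marks_incl qm; apply: geq_minr.
Qed.

(** The counterpart of the position [f p] lies on neither side of [p], hence is [p]. So mimicry
    already forces [f] to respect letters and order. *)
Lemma mimics_mark p : p \in marks w k ->
  nth x0 w p = nth x0 w' (f p) /\
  forall q, q \in marks w k -> (q < p) = (f q < f p).
Proof.
move=> pm; have [y [ly /eqP ely H]] := mim (f_range pm).
have ey : y = p by have := H _ pm; rewrite !ltnn; lia.
by rewrite ey in ely H; split=> // q /H [].
Qed.

Lemma mark_graph_marked_pair : marked_pair x0 w w' mark_graph k.
Proof.
(* The counterpart of position 0 is not before the mark 0, so 0 is not before [f 0]; the last
   positions are treated symmetrically. *)
have f0 : f 0 = 0.
  have m0 : 0 \in marks w k by apply: (@marks_incl w 0) => //; rewrite inE.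
  have [y [ly _ H]] := mim (y' := 0) (ltac:(by case: w' wn')).
  by have := H _ m0; lia.
have fl : f (size w).-1 = (size w').-1.
  have m0 : (size w).-1 \in marks w k.
    by apply: (@marks_incl w 0) => //; rewrite !inE eqxx orbT.
  have lw : (size w').-1 < size w' by case: w' wn'.
  have [y [ly _ H]] := mim lw.
  by have := H _ m0; have := f_range m0; lia.
have in_graph r q : q \in marks w (minn r k) -> (q, f q) \in mark_graph r.
  by move=> qm; apply/mapP; exists q.
split.
- move=> r g /mapP [q qm ->]; apply: in_graph; apply: marks_incl qm; lia.
- move=> r g h rk /mark_graphP [_ gm ->] /mark_graphP [_ hm ->].
  by have [_ ->] := mimics_mark hm.
- move=> r g rk /mark_graphP [_ gm ->]; have [-> _] := mimics_mark gm.
  by split=> //; [apply: marks_range gm|apply: f_range].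
- move=> r; rewrite -{2}f0; apply: in_graph.
  by apply: (@marks_incl w 0) => //; rewrite inE.
- move=> r; rewrite -fl; apply: in_graph.
  by apply: (@marks_incl w 0) => //; rewrite !inE eqxx orbT.
move=> r g j rk /mark_graphP [gm _ _] lj.
have mr : minn r.+1 k = r.+1 by lia.
have mr' : minn r k = r by lia.
split=> [/(next_posP lj)|/(prev_posP w)] H.
  exists (next_pos w (nth x0 w j) g.1, f (next_pos w (nth x0 w j) g.1)) => //.
  apply: in_graph; rewrite mr /= !mem_cat; apply/or3P/Or32/allpairsP.
  by exists (g.1, nth x0 w j); rewrite /= -mr' mem_enum; split.
exists (prev_pos w (nth x0 w j) g.1, f (prev_pos w (nth x0 w j) g.1)) => //.
apply: in_graph; rewrite mr /= !mem_cat; apply/or3P/Or33/allpairsP.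
by exists (g.1, nth x0 w j); rewrite /= -mr' mem_enum; split.
Qed.

(** A position of [w'] is replaced by its counterpart [y] in [w]. The mark refining at [y] has the
    right letter, and its partner lies on the same side of the original position. *)
Lemma mark_graph_refine' : marks_refine x0 w' (swap_marks mark_graph) k.
Proof.
move=> r [g' g] j rk; rewrite mem_swap_marks => gG lj.
have mp := mark_graph_marked_pair.
have [_ /= gm g1] := mark_graphP gG.
have [y [ly /eqP ely H]] := mim lj.
have [H1 H2] := H _ gm.
have [R1 R2] := mp_refine mp rk gG ly.
split=> /= gj.
  have [|[h h'] hG [/= h1 h2]] := R1; first by rewrite /= H1 -g1.
  have [_ _ /= l] := mp_letter mp (r := r.+1) rk hG.
  have /= m := mp_mono mp (r := r.+1) rk (mp_incl mp gG) hG.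
  have [_ /= hm h3] := mark_graphP hG.
  have [H3 H4] := H _ hm.
  exists (h', h); first by rewrite mem_swap_marks.
  rewrite /= -ely -h2 l; split=> //; rewrite -m [h' <= _]leqNgt h3 -H4 -leqNgt.
  exact: h1.
have [|[h h'] hG [/= h1 h2]] := R2; first by rewrite /= H2 -g1.
have [_ _ /= l] := mp_letter mp (r := r.+1) rk hG.
have /= m := mp_mono mp (r := r.+1) rk hG (mp_incl mp gG).
have [_ /= hm h3] := mark_graphP hG.
have [H3 H4] := H _ hm.
exists (h', h); first by rewrite mem_swap_marks.
rewrite /= -ely -h2 l; split=> //; rewrite -m [_ <= h']leqNgt h3 -H3 -leqNgt.
exact: h1.
Qed.

End Marks.

Lemma FO2_two_names (Sig : finType) (phi : formula Sig) :
  FO2 phi -> exists x y, {subset var_names phi <= [:: x; y]}.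
Proof.
rewrite /FO2 => H; set s := undup _ in H; exists (nth 0 s 0), (nth 0 s 1) => z.
by rewrite -mem_undup -/s; case: s H => [|a [|b []]] //= _; rewrite !inE // => ->.
Qed.

Theorem FO2_mimics (Sig : finType) (phi : formula Sig) (w w' : word Sig) f :
  FO2 phi -> w != [::] -> w' != [::] ->
  (forall q, q \in marks set0 w (qdepth phi) -> f q < size w') ->
  mimics set0 (fun a b => a == b) w w' (marks set0 w (qdepth phi)) f ->
  models w phi = models w' phi.
Proof.
move=> /FO2_two_names [x [y sub]] wn wn' fr mim.
have mp := mark_graph_marked_pair wn wn' fr mim.
apply: (sat_matched mp (mark_graph_refine' wn wn' fr mim) sub (leqnn _) (leqnn _)).
(* The constant valuation of [models] puts both pebbles on position 0, which is a mark. *)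
have m0 := mp_first mp (qdepth phi).
have [l1 l2 l3] := mp_letter mp (leqnn _) m0.
by split=> // u _; split=> //; apply: (same_side_mark mp (leqnn _) m0).
Qed.

(** * Sigma2 formulas for marked words *)

Lemma finite_choice (T : Type) (n : nat) (P : nat -> T -> Prop) (t0 : T) :
  (forall i, i < n -> exists t, P i t) ->
  exists g : nat -> T, forall i, i < n -> P i (g i).
Proof.
elim: n => [|n IH] H; first by exists (fun=> t0).
have [g gP] := IH (fun i lt_in => H i (ltnW lt_in)).
have [t tP] := H n (ltnSn n).
exists (fun i => if i == n then t else g i) => i; rewrite ltnS leq_eqVlt.
by case: eqP => [-> //|_] /= /gP.
Qed.

(** Used to collect the profile sets realized by words of an arbitrary language, hence the classical
    argument. *)
Lemma finite_comprehension (T : finType) (P : T -> Prop) :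
  exists s : seq T, forall t, t \in s <-> P t.
Proof.
have [s H] : exists s : seq T, forall t, t \in s <-> t \in enum T /\ P t.
  elim: (enum T) => [|a r [s IH]]; first by exists [::] => t; split=> // -[].
  have [Pa|nPa] := classic (P a).
    exists (a :: s) => t; rewrite !inE; split.
      by case/orP => [/eqP ->|/IH [-> ?]]; rewrite ?eqxx ?orbT.
    by case=> /orP [-> //|tr Pt]; apply/orP; right; apply/IH.
  exists s => t; rewrite inE; split=> [/IH [-> ?]|]; first by rewrite orbT.
  by case=> /orP [/eqP -> //|tr Pt]; apply/IH.
by exists s => t; split=> [/H [] //|Pt]; apply/H; rewrite mem_enum.
Qed.

Section ProfileFormula.
Variables (Sig : finType) (n : nat).
Variables (ltest : letter Sig -> nat -> formula Sig) (lrel : rel (letter Sig)).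
Hypothesis sat_ltest : forall w e b v,
  sat w e (ltest b v) = lrel b (nth set0 w (e v)).
Hypothesis free_vars_ltest : forall b v, {subset free_vars (ltest b v) <= [:: v]}.
Implicit Types (w : word Sig) (Q : seq nat).

Definition profile_type := (letter Sig * {ffun 'I_n -> bool * bool})%type.

Definition profile w Q y : profile_type :=
  (nth set0 w y, [ffun i : 'I_n => (nth 0 Q i < y, y < nth 0 Q i)]).

Definition profiles w Q : {set profile_type} :=
  [set profile w Q y | y : 'I_(size w)].

Definition order_formula (o : bool * bool) x v : formula Sig :=
  if o.1 then FBin BLt x v else if o.2 then FBin BLt v x else FBin BEq x v.

Definition profile_formula (t : profile_type) v :=
  FAnd (ltest t.1 v) (big_and [seq order_formula (t.2 i) i v | i <- enum 'I_n]).

Definition profiles_formula (S : {set profile_type}) v :=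
  big_or [seq profile_formula t v | t <- enum S].

(** Names below [n] denote the marks, and [n + j] is the universal variable of the disjunct number
    [j]. *)
Definition matrix_formula (Ss : seq {set profile_type}) :=
  big_or [seq profiles_formula (nth set0 Ss j) (n + j) | j <- iota 0 (size Ss)].

Definition marked_formula Ss : formula Sig :=
  FExs (iota 0 n) (FAlls (iota n (size Ss)) (matrix_formula Ss)).

Lemma sat_profile_formula w w' Q y e v :
  sat w' e (profile_formula (profile w Q y) v) <->
  lrel (nth set0 w y) (nth set0 w' (e v)) /\
  forall i, i < n -> (nth 0 Q i < y) = (e i < e v) /\ (y < nth 0 Q i) = (e v < e i).
Proof.
rewrite /= sat_ltest sat_big_and all_map.
have ordP i : sat w' e (order_formula ((profile w Q y).2 i) i v) <->
    (nth 0 Q i < y) = (e i < e v) /\ (y < nth 0 Q i) = (e v < e i).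
  rewrite /= ffunE /order_formula /=; case: (ltngtP (nth 0 Q i) y) => _ /=; lia.
split=> [/andP [-> /allP H]|[-> H]]; last first.
  by apply/allP => i _; apply/ordP; apply: H.
by split=> // i lt_in; apply: (ordP (Ordinal lt_in)).1; apply: H; rewrite mem_enum.
Qed.

Lemma free_vars_profiles_formula S v :
  {subset free_vars (profiles_formula S v) <= v :: iota 0 n}.
Proof.
move=> z; rewrite free_vars_big_or -map_comp => /flatten_mapP [t _].
rewrite /= mem_cat => /orP [/free_vars_ltest|]; first by rewrite !inE => ->.
rewrite free_vars_big_and -map_comp => /flatten_mapP [i _] /=.
have : {subset free_vars (order_formula (t.2 i) i v) <= [:: val i; v]}.
  rewrite /order_formula => u; case: ifP => _; last case: ifP => _;
    by rewrite /= !inE // orbC.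
move=> H /H; rewrite !inE => /orP [/eqP ->|->] //.
by rewrite mem_iota ltn_ord orbT.
Qed.

Lemma sentence_marked_formula Ss : sentence (marked_formula Ss).
Proof.
apply: sentence_prenex => z.
rewrite free_vars_big_or -map_comp => /flatten_mapP [j jm].
move/free_vars_profiles_formula; rewrite mem_cat inE !mem_iota.
by move: jm; rewrite mem_iota; lia.
Qed.

(* Each disjunct has its own universal variable, so that the disjunction
   commutes with the universal quantifiers. *)
Lemma models_marked_formula w Ss : w != [::] ->
  models w (marked_formula Ss) <->
  exists2 e, in_range w e & exists2 S, S \in Ss & forall y, y < size w ->
    exists2 t, t \in S & sat w (update e n y) (profile_formula t n).
Proof.
move=> wn; rewrite models_prenex ?sentence_marked_formula //.
have w0 : 0 < size w by case: w wn.
have sat_move e e' v S : (forall i, i < n -> e i = e' i) ->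
    sat w e (profiles_formula S v) =
    has (fun t => sat w (update e' n (e v)) (profile_formula t n)) (enum S).
  move=> H; rewrite sat_big_or has_map; apply: eq_has => t /=.
  rewrite !sat_ltest /update eqxx !sat_big_and !all_map; congr (_ && _).
  apply: eq_all => i /=; rewrite /order_formula.
  by case: ifP => _; last case: ifP => _; rewrite /= /update eqxx (ltn_eqF (ltn_ord i)) (H _ (ltn_ord i)).
split=> -[e er].
  move=> H; apply: NNPP => no; move: H.
  have {}no j : j < size Ss -> exists y : nat, y < size w /\
      forall t, t \in nth set0 Ss j -> ~~ sat w (update e n y) (profile_formula t n).
    move=> lj; apply: NNPP => no2; case: no; exists e => //.
    exists (nth set0 Ss j); first exact: mem_nth.
    move=> y ly; apply: NNPP => no3; case: no2; exists y; split=> // t tS.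
    by apply/negP => st; case: no3; exists t.
  have [g gP] := finite_choice 0 no.
  (* If each disjunct fails somewhere, sending its own variable to such a position falsifies the
     whole disjunction at once. *)
  pose e' x := if (n <= x < n + size Ss) then g (x - n) else e x.
  move=> H; have : sat w e' (matrix_formula Ss).
    apply: H => x; last by rewrite mem_iota /e' => /negbTE ->.
    rewrite /e'; case: ifP => // H.
    by have [] := gP (x - n) (ltac:(lia)).
  rewrite sat_big_or has_map => /hasP [j]; rewrite mem_iota => /andP [_ lj] /=.
  rewrite (sat_move e' e) => [|i lt_in]; last by rewrite /e' leqNgt lt_in.
  case/hasP => t; rewrite mem_enum => tS; apply/negP.
  have -> : e' (n + j) = g j by rewrite /e' leq_addr ltn_add2l lj addKn.
  by apply: (gP _ lj).2.
case=> S SS H; exists e => // e' er' ee'; rewrite sat_big_or has_map.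
apply/hasP; exists (index S Ss); first by rewrite mem_iota index_mem.
rewrite /= nth_index // (sat_move e' e) => [|i lt_in]; last first.
  by rewrite ee' // mem_iota leqNgt lt_in.
by have [t tS st] := H _ (er' (n + index S Ss)); apply/hasP; exists t; rewrite ?mem_enum.
Qed.

Lemma quantifier_free_matrix Ss :
  (forall b v, quantifier_free (ltest b v)) -> quantifier_free (matrix_formula Ss).
Proof.
move=> H; rewrite quantifier_free_big_or all_map; apply/allP => j _ /=.
rewrite quantifier_free_big_or all_map; apply/allP => t _ /=.
rewrite H quantifier_free_big_and all_map; apply/allP => i _ /=.
by rewrite /order_formula; case: ifP => _; last case: ifP.
Qed.

(** The disjuncts are the profile sets of the words of [L]. If [w] satisfies the one coming from
    [u], replacing each letter of [w] by that of a counterpart in [u] gives a word [v] that mimics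
    [u] exactly. So [v] is in [L], and closure under [lrel] leads from [v] to [w]. *)
Lemma marked_formula_defines (L : language Sig) k :
  n = nmarks (letter Sig) k -> reflexive lrel ->
  (forall u v : word Sig, size u = size v ->
     (forall i, i < size u -> lrel (nth set0 u i) (nth set0 v i)) -> L u -> L v) ->
  (forall (w w' : word Sig) f, w != [::] -> w' != [::] ->
     (forall q, q \in marks set0 w k -> f q < size w') ->
     mimics set0 (fun a b => a == b) w w' (marks set0 w k) f -> L w -> L w') ->
  exists Ss, defines (marked_formula Ss) L.
Proof.
move=> nE lrefl Lclosed Lmim.
have [Ss SsP] := finite_comprehension (fun S : {set profile_type} =>
  exists w : word Sig, [/\ w != [::], L w & S = profiles w (marks set0 w k)]).
exists Ss => w wn; rewrite models_marked_formula //; split=> [Lw|].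
  exists (fun x => nth 0 (marks set0 w k) x) => [x|].
    have [lx|lx] := ltnP x (size (marks set0 w k)).
      exact: marks_range wn (mem_nth _ lx).
    by rewrite nth_default //; case: (w) wn.
  exists (profiles w (marks set0 w k)); first by apply/SsP; exists w.
  move=> y ly; exists (profile w (marks set0 w k) y).
    by apply/imsetP; exists (Ordinal ly).
  apply/sat_profile_formula; rewrite /update eqxx; split=> // i lt_in.
  by rewrite ltn_eqF.
case=> e er [_ /SsP [u [un Lu ->]] H].
set Q := marks set0 u k in H.
have Qn : size Q = n by rewrite size_marks nE.
have {}H y : y < size w -> exists x, [/\ x < size u,
    lrel (nth set0 u x) (nth set0 w y) &
    forall i, i < n -> (nth 0 Q i < x) = (e i < y) /\ (x < nth 0 Q i) = (y < e i)].
  move=> /H [t /imsetP [x _ ->] /sat_profile_formula []].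
  rewrite /update eqxx => h1 h2; exists x; split=> // i lt_in.
  by have := h2 i lt_in; rewrite ltn_eqF.
have [g gP] := finite_choice 0 H.
pose v := mkseq (fun y => nth set0 u (g y)) (size w).
have sv : size v = size w by rewrite size_mkseq.
apply: (Lclosed v) => //.
  by move=> i; rewrite sv => li; rewrite nth_mkseq //; have [] := gP i li.
apply: (Lmim u v (fun q => e (index q Q))) => //.
- by rewrite -size_eq0 sv size_eq0.
- by move=> q _; rewrite sv.
move=> y; rewrite sv => ly; have [h1 h2 h3] := gP y ly.
exists (g y); split=> //; first by rewrite nth_mkseq.
move=> q qQ; have lq : index q Q < n by rewrite -Qn index_mem.
by have := h3 _ lq; rewrite nth_index.
Qed.

End ProfileFormula.

(** * Positive Sigma2 and Pi2 formulas for monotone two-variable languages *)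

Section FromFO2.
Variable Sig : finType.
Implicit Types (L : language Sig).

Definition above_test (b : letter Sig) v : formula Sig :=
  big_and [seq FLetter s v | s <- enum b].

(** Every letter occurs negated, so that applying [neg] to a matrix built from these tests removes
    all negations. *)
Definition below_test (b : letter Sig) v : formula Sig :=
  big_and [seq FNot (FLetter s v) | s <- enum (~: b)].

Lemma sat_above_test w e b v :
  sat w e (above_test b v) = (b \subset nth set0 w (e v)).
Proof.
rewrite sat_big_and all_map; apply/allP/subsetP => H x.
  by move=> xb; apply: H; rewrite mem_enum.
by rewrite mem_enum => /H.
Qed.

Lemma sat_below_test w e b v :
  sat w e (below_test b v) = (nth set0 w (e v) \subset b).
Proof.
rewrite sat_big_and all_map; apply/allP/subsetP => H x.
  by move=> xb; apply: contraTT xb => xb; apply: H; rewrite mem_enum inE.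
by rewrite mem_enum inE; apply: contra => /H.
Qed.

Lemma negation_free_matrix n Ss : negation_free (matrix_formula (n := n) above_test Ss).
Proof.
rewrite /matrix_formula; elim: (iota _ _) => //= j js -> /=; rewrite andbT.
rewrite /profiles_formula; elim: (enum _) => //= t ts -> /=; rewrite andbT.
apply/andP; split; first by rewrite /above_test; elim: (enum _) => //=.
elim: (enum _) => //= i r -> /=; rewrite andbT /order_formula.
by case: ifP => _; last case: ifP.
Qed.

Lemma negation_free_neg_matrix n Ss :
  negation_free (neg (matrix_formula (n := n) below_test Ss)).
Proof.
rewrite /matrix_formula; elim: (iota _ _) => //= j js -> /=; rewrite andbT.
rewrite /profiles_formula; elim: (enum _) => //= t ts -> /=; rewrite andbT.
apply/andP; split; first by rewrite /below_test; elim: (enum _) => //=.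
elim: (enum _) => //= i r -> /=; rewrite andbT /order_formula.
by case: ifP => _; last case: ifP.
Qed.

Theorem monotone_FO2_Sigma2_pos L :
  monotone L -> definable_in (@FO2 Sig) L -> definable_in (@Sigma2_pos Sig) L.
Proof.
move=> Lmon [phi [phi2 _ def]].
have [||u v suv H|w w' f wn wn' fr mim|Ss defS] :=
  @marked_formula_defines Sig (nmarks (letter Sig) (qdepth phi)) above_test
    (fun a b => a \subset b) sat_above_test _ L (qdepth phi) erefl.
- move=> b v z; rewrite free_vars_big_and -map_comp => /flatten_mapP [s _] //.
- by move=> a; apply: subxx.
- move=> Lu; apply: Lmon Lu _; apply/word_leP; split=> // i.
  have [/H //|li] := ltnP i (size u); by rewrite nth_default ?sub0set.
- by rewrite !def // (FO2_mimics phi2 wn wn' fr mim).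
eexists; split; last exact: defS; last first.
  by apply: sentence_marked_formula => b v z; rewrite free_vars_big_and -map_comp => /flatten_mapP [s _].
split; last by rewrite negation_free_FExs negation_free_FAlls negation_free_matrix.
eexists _, _, _; split; last by [].
apply: quantifier_free_matrix => b v; rewrite quantifier_free_big_and all_map.
exact/allP.
Qed.

(** The complement of [L] is closed under shrinking letters, hence is defined by a marked formula
    with [below_test]. The dual of that formula is a positive Pi2 formula for [L]. *)
Theorem monotone_FO2_Pi2_pos L :
  monotone L -> definable_in (@FO2 Sig) L -> definable_in (@Pi2_pos Sig) L.
Proof.
move=> Lmon [phi [phi2 _ def]].
have [||u v suv H|w w' f wn wn' fr mim|Ss defS] :=
  @marked_formula_defines Sig (nmarks (letter Sig) (qdepth phi)) below_test
    (fun a b => b \subset a) sat_below_test _ (fun w => ~ L w) (qdepth phi) erefl.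
- move=> b v z; rewrite free_vars_big_and -map_comp => /flatten_mapP [s _] //.
- by move=> a; apply: subxx.
- move=> Lu Lv; apply: Lu; apply: Lmon Lv _; apply/word_leP; split=> // i.
  have [/H //|li] := ltnP i (size u); by rewrite nth_default ?sub0set // -suv.
- by rewrite !def // (FO2_mimics phi2 wn wn' fr mim).
exists (neg (marked_formula below_test Ss)); split.
- split; last first.
    by rewrite neg_FExs neg_FAlls negation_free_FAlls negation_free_FExs negation_free_neg_matrix.
  rewrite /marked_formula neg_FExs neg_FAlls; eexists _, _, _; split; last by [].
  apply: quantifier_free_neg; apply: quantifier_free_matrix => b v.
  by rewrite quantifier_free_big_and all_map; apply/allP.
- rewrite sentence_neg.
  by apply: sentence_marked_formula => b v z; rewrite free_vars_big_and -map_comp => /flatten_mapP [s _].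
move=> w wn; rewrite /models sat_neg; split=> [Lw|/negP nS].
  by apply/negP => /(defS w wn).
by apply: NNPP => nL; apply: nS; apply/(defS w wn).
Qed.

End FromFO2.

(** * Congruences in DA *)

Definition power (A : Type) (u : seq A) n := flatten (nseq n u).

Lemma powerD (A : Type) (u : seq A) m n : power u (m + n) = power u m ++ power u n.
Proof. by rewrite /power nseqD flatten_cat. Qed.

Lemma power1 (A : Type) (u : seq A) : power u 1 = u.
Proof. exact: cats0. Qed.

Lemma powerSr (A : Type) (u : seq A) n : power u n.+1 = power u n ++ u.
Proof. by rewrite -addn1 powerD power1. Qed.

Lemma powerM (A : Type) (u : seq A) m n : power (power u m) n = power u (m * n).
Proof. by elim: n => [|n IH]; rewrite ?muln0 // mulnS powerD -IH. Qed.

Lemma rev_power (A : Type) (u : seq A) n : rev (power u n) = power (rev u) n.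
Proof. by elim: n => // n IH; rewrite powerSr rev_cat IH. Qed.

Lemma mem_power (A : eqType) (u : seq A) n : {subset power u n <= u}.
Proof. by move=> x /flattenP [v /nseqP [->]]. Qed.

Lemma first_occurrence (A : eqType) (a : A) u :
  a \in u -> exists u0 u1, u = u0 ++ a :: u1 /\ a \notin u0.
Proof.
elim: u => // b u IH; rewrite inE; case: eqVneq => [->|ab] /=.
  by exists [::], u.
by case/IH => u0 [u1 [-> H]]; exists (b :: u0), u1; rewrite inE negb_or ab.
Qed.

(** No quotient is formed: finite index is expressed by a map [tau] to a finite type whose kernel
    refines [eqv]. The last clause is the condition characterizing DA. *)
Definition DA_congruence (A : finType) (T : finType) (N : nat)
    (eqv : seq A -> seq A -> Prop) (tau : seq A -> T) :=
  [/\ forall u, eqv u u,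
      forall u v, eqv u v -> eqv v u,
      forall u v w, eqv u v -> eqv v w -> eqv u w &
      [/\ forall c u v d, eqv u v -> eqv (c ++ u ++ d) (c ++ v ++ d),
          forall u v, tau u = tau v -> eqv u v &
          forall u x, {subset x <= u} ->
            eqv (power u N) (power u N ++ x ++ power u N)]].

(** Splitting at the first occurrence of a letter costs one level. Last occurrences are covered by
    applying the notion to reversed words. *)
Definition factor_refining (A : finType) (agr : nat -> seq A -> seq A -> Prop) :=
  [/\ forall m u v, agr m u v -> u =i v,
      forall m u v, agr m.+1 u v -> agr m u v &
      forall m u0 a u1 v0 v1, a \notin u0 -> a \notin v0 ->
        agr m.+1 (u0 ++ a :: u1) (v0 ++ a :: v1) -> agr m u0 v0 /\ agr m u1 v1].

Section RightFactor.
Variables (A T : finType) (N : nat) (eqv : seq A -> seq A -> Prop) (tau : seq A -> T).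
Variable agr : nat -> seq A -> seq A -> Prop.
Hypothesis da : DA_congruence N eqv tau.
Hypothesis fr : factor_refining agr.

Let erefl := let: And4 h _ _ _ := da in h.
Let esym := let: And4 _ h _ _ := da in h.
Let etrans := let: And4 _ _ h _ := da in h.
Let econg := let: And4 _ _ _ (And3 h _ _) := da in h.
Let etau := let: And4 _ _ _ (And3 _ h _) := da in h.
Let epow := let: And4 _ _ _ (And3 _ _ h) := da in h.
Let agr_mem := let: And3 h _ _ := fr in h.
Let agr_mono := let: And3 _ h _ := fr in h.
Let agr_first := let: And3 _ _ h := fr in h.

Lemma eqv_catl c u v : eqv u v -> eqv (c ++ u) (c ++ v).
Proof. by move/(econg c [::]); rewrite !cats0. Qed.

Lemma eqv_catr d u v : eqv u v -> eqv (u ++ d) (v ++ d).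
Proof. exact: (econg [::]). Qed.

Lemma eqv_power p u n : eqv p (p ++ u) -> eqv p (p ++ power u n).
Proof.
move=> H; elim: n => [|n IH]; first by rewrite cats0.
apply: etrans IH _; rewrite -[n.+1]add1n powerD power1.
by rewrite catA; apply: eqv_catr.
Qed.

Lemma eqv_power_sandwich l p r n :
  eqv p (l ++ p ++ r) -> eqv p (power l n ++ p ++ power r n).
Proof.
move=> H; elim: n => [|n IH]; first by rewrite cats0.
apply: etrans IH _; apply: etrans (econg _ _ H) _.
by rewrite powerSr -[n.+1]add1n powerD power1 -!catA.
Qed.

(** Taking for [x] the empty word and then [u] gives [u^N u ~ u^N u^N u = u^N u u^N ~ u^N]. *)
Lemma aperiodic u : eqv (power u N.+1) (power u N).
Proof.
have h1 := epow (u := u) (x := [::]) (ltac:(by [])).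
have h2 := epow (u := u) (x := u) (ltac:(by [])).
apply: etrans (esym h2).
rewrite powerSr; apply: etrans (eqv_catr _ h1) _; rewrite /= -!catA -powerSr.
exact: erefl.
Qed.

(* Inside an R-class every letter already read may be read again; this is the
   defining feature of DA. *)
Lemma return_letters p u v y :
  eqv p (p ++ u ++ y) -> {subset v <= u} -> exists z, eqv p (p ++ v ++ z).
Proof.
(* The chain is [p ~ p (uy)^N ~ p (uy)^N v (uy)^N ~ p v (uy)^N]. *)
move=> H sub; exists (power (u ++ y) N).
apply: etrans (eqv_power N H) _.
have sub' : {subset v <= u ++ y} by move=> x /sub; rewrite mem_cat => ->.
apply: etrans (eqv_catl p (epow sub')) _.
rewrite !catA; apply: (eqv_catr (power _ _)); apply: (eqv_catr v); apply: esym.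
exact: eqv_power.
Qed.

(** That some [y] satisfies [eqv p (p ++ u ++ y)] means that [p] and [p ++ u] are R-equivalent; [a]
    is the letter of [u] at which the R-class of [p] is left. *)
Lemma first_drop p u :
  ~ (exists y, eqv p (p ++ u ++ y)) ->
  exists u0 a u1, [/\ u = u0 ++ a :: u1, exists y, eqv p (p ++ u0 ++ y) &
                     ~ exists y, eqv p (p ++ (u0 ++ [:: a]) ++ y)].
Proof.
elim/last_ind: u => [|u a IH] H.
  by case: H; exists [::]; rewrite !cats0; apply: erefl.
have [ex|/IH [u0 [b [u1 [-> H1 H2]]]]] := classic (exists y, eqv p (p ++ u ++ y)).
  by exists u, a, [::]; rewrite cats1.
by exists u0, b, (rcons u1 a); split=> //; rewrite rcons_cat.
Qed.

(** Induction on the size of a set [D] of types containing those of all words below [p] in the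
    R-order. If [u] stays in the R-class of [p], so does [v], having the same letters. Otherwise
    [u = u0 a u1], where [a] leaves the class and by [return_letters] does not occur in [u0].
    Splitting [v] at its first [a], the hypothesis on smaller alphabets gives [u0 ~ v0], and the
    induction continues after [a]. *)
Lemma right_factor c m0 :
  (forall u v, size (undup u) <= c -> agr m0 u v -> eqv u v) ->
  forall r (D : {set T}) p u v,
    (forall q x, eqv q (p ++ x) -> tau q \in D) -> #|D| <= r ->
    size (undup u) <= c.+1 -> agr (m0 + r) u v ->
    exists y, eqv (p ++ u) (p ++ v ++ y).
Proof.
move=> IHc; elim=> [|r IHr] D p u v HD cD cu uv.
  have := HD p [::]; rewrite cats0 => /(_ (erefl p)).
  by move: cD; rewrite leqn0 cards_eq0 => /eqP ->; rewrite inE.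
have uv_mem := agr_mem uv.
have [[y Hy]|drop] := classic (exists y, eqv p (p ++ u ++ y)).
  have [|z Hz] := return_letters Hy (v := v); first by move=> x; rewrite uv_mem.
  by exists (z ++ u); have := eqv_catr u Hz; rewrite -!catA.
have [u0 [a [u1 [def_u [y Hy] Hdrop]]]] := first_drop drop.
have au0 : a \notin u0.
  apply/negP => au0; apply: Hdrop; apply: (return_letters Hy) => x.
  by rewrite mem_cat inE => /orP [//|/eqP ->].
have [v0 [v1 [def_v av0]]] : exists v0 v1, v = v0 ++ a :: v1 /\ a \notin v0.
  by apply: first_occurrence; rewrite -uv_mem def_u mem_cat inE eqxx orbT.
rewrite def_u def_v addnS in uv; have [uv0 uv1] := agr_first au0 av0 uv.
have e0 : eqv u0 v0.
  apply: IHc.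
    rewrite -ltnS; apply: leq_trans cu.
    have : uniq (a :: undup u0) by rewrite /= mem_undup au0 undup_uniq.
    move/uniq_leq_size; apply=> x; rewrite inE !mem_undup def_u mem_cat inE.
    by case/orP => ->; rewrite ?orbT.
  move: uv0; elim: (r) => [|s IHs]; first by rewrite addn0.
  by rewrite addnS => /agr_mono.
(* A word below [p u0 a] with the type of [p] would lead back to the R-class just left, so [tau p]
   can be removed from [D]. *)
have [|||y1 Hy1] := IHr (D :\ tau p) (p ++ u0 ++ [:: a]) u1 v1 _ _ _ uv1.
- move=> q x Hq; rewrite !inE; apply/andP; split; last first.
    by apply: (HD q ((u0 ++ [:: a]) ++ x)); rewrite catA.
  apply/eqP => /etau qp; apply: Hdrop; exists x.
  by apply: etrans (esym qp) _; rewrite catA.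
- have : tau p \in D by apply: (HD p [::]); rewrite cats0; apply: erefl.
  by move=> pD; move: cD; rewrite (cardsD1 (tau p)) pD add1n ltnS.
- apply: leq_trans cu; apply: uniq_leq_size (undup_uniq _) _ => x.
  by rewrite !mem_undup def_u mem_cat inE => ->; rewrite !orbT.
exists y1; rewrite def_u def_v.
rewrite -[a :: u1]cat1s -[a :: v1]cat1s !catA in Hy1 *.
apply: etrans Hy1 _; rewrite -!catA; apply: eqv_catl.
exact: eqv_catr e0.
Qed.

End RightFactor.

Section Factor.
Variables (A T : finType) (N : nat) (eqv : seq A -> seq A -> Prop) (tau : seq A -> T).
Variable agr : nat -> seq A -> seq A -> Prop.

Lemma DA_congruence_rev : DA_congruence N eqv tau ->
  DA_congruence N (fun u v => eqv (rev u) (rev v)) (tau \o rev).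
Proof.
case=> h1 h2 h3 [h4 h5 h6]; split=> //.
- by move=> u v; apply: h2.
- by move=> u v w; apply: h3.
split.
- by move=> c u v d H; rewrite !rev_cat -!catA; apply: h4.
- by move=> u v /h5.
move=> u x sub; rewrite !rev_cat rev_power -catA; apply: h6 => y.
by rewrite !mem_rev; apply: sub.
Qed.

Theorem DA_factor_refining :
  DA_congruence N eqv tau -> factor_refining agr ->
  factor_refining (fun m u v => agr m (rev u) (rev v)) ->
  (forall m u v, agr m u v -> agr m v u) ->
  forall c, exists m, forall u v, size (undup u) <= c -> agr m u v -> eqv u v.
Proof.
move=> da fr fr' agr_sym; have [eqr eqs eqt [eqc _ _]] := da.
have [agr_mem _ _] := fr.
elim=> [|c [m0 IH]].
  exists 0 => u v; rewrite leqn0 size_eq0 => /eqP u0 /agr_mem uv.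
  have {}u0 : u = [::] by apply: undup_nil.
  have -> : v = [::] by case: v uv => // b v /(_ b); rewrite u0 inE eqxx.
  by rewrite u0; apply: eqr.
(* At most [#|T|] R-classes are left, each at the cost of one level, and [m0] levels remain for the
   smaller alphabet. *)
exists (m0 + #|T|) => u v cu uv.
have cv : size (undup v) <= c.+1.
  apply: leq_trans cu; apply: uniq_leq_size (undup_uniq _) _ => x.
  by rewrite !mem_undup (agr_mem _ _ _ uv).
have [|y Hy] := right_factor da fr IH (D := setT) (p := [::]) _ (max_card _) cu uv.
  by move=> *; rewrite inE.
have IH' u' v' : size (undup u') <= c -> agr m0 (rev u') (rev v') -> eqv (rev u') (rev v').
  move=> cu'; apply: IH; apply: leq_trans cu'.
  by apply: uniq_leq_size (undup_uniq _) _ => x; rewrite !mem_undup mem_rev.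
have [|||z Hz] := right_factor (DA_congruence_rev da) fr' IH' (D := setT) (p := [::])
  (u := rev v) (v := rev u) _ (max_card _).
- by move=> *; rewrite inE.
- apply: leq_trans cv.
  by apply: uniq_leq_size (undup_uniq _) _ => x; rewrite !mem_undup mem_rev.
- by rewrite !revK; apply: agr_sym.
rewrite /= rev_cat !revK in Hy Hz.
set l := rev z in Hz.
(* Now [u ~ v y] and [v ~ l u], so that [u ~ l^n u y^n] for every [n]. *)
have H : eqv u (l ++ u ++ y).
  by apply: (eqt _ _ _ Hy); rewrite catA; apply: (eqv_catr da _ Hz).
have HN := eqv_power_sandwich da N H.
(* By aperiodicity, [v ~ l u ~ l^(N+1) u y^N ~ l^N u y^N ~ u]. *)
apply: (eqs); apply: (eqt _ _ _ Hz).
apply: (eqt _ _ _ (eqv_catl da l HN)); apply: (eqs); apply: (eqt _ _ _ HN).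
rewrite [l ++ _]catA; apply: (eqv_catr da).
by apply: (eqs); apply: (aperiodic da).
Qed.

End Factor.

(** * Two-variable tests refining factorizations *)

Lemma all_flatten (T : Type) (p : pred T) ss : all p (flatten ss) = all (all p) ss.
Proof. by elim: ss => //= s ss IH; rewrite all_cat IH. Qed.

Section Tests.
Variable Sig : finType.
Implicit Types (phi : formula Sig) (u v w : word Sig) (a : letter Sig).

Definition letter_formula a x : formula Sig :=
  big_and [seq if s \in a then FLetter s x else FNot (FLetter s x) | s <- enum Sig].

Arguments letter_formula : simpl never.

Lemma sat_letter_formula w e a x :
  sat w e (letter_formula a x) = (nth set0 w (e x) == a).
Proof.
rewrite sat_big_and all_map; apply/allP/eqP => [H|wa s _] /=.
  by apply/setP => s; have := H s; rewrite mem_enum /= => /(_ isT); case: ifP => _ // /negbTE.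
by case: ifP => sa /=; rewrite wa sa.
Qed.

Lemma var_names_letter_formula a x : {subset var_names (letter_formula a x) <= [:: x]}.
Proof.
by move=> z; rewrite var_names_big_and -map_comp => /flatten_mapP [s _] /=; case: ifP.
Qed.

Lemma free_vars_letter_formula a x : {subset free_vars (letter_formula a x) <= [:: x]}.
Proof.
by move=> z; rewrite free_vars_big_and -map_comp => /flatten_mapP [s _] /=; case: ifP.
Qed.

Definition other x := if x == 0 then 1 else 0.

(** The bound variable is the other one of the two names 0 and 1, so a guard introduces no third
    variable. *)
Definition occurs_strictly (left : bool) a x : formula Sig :=
  let y := other x in
  FEx y (FAnd (if left then FBin BLt y x else FBin BLt x y) (letter_formula a y)).

Definition absent_weakly (left : bool) a x : formula Sig :=
  let y := other x in
  FAll y (FOr (if left then FBin BLt x y else FBin BLt y x) (FNot (letter_formula a y))).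

Fixpoint relativize (g : nat -> formula Sig) phi : formula Sig :=
  match phi with
  | FNot p => FNot (relativize g p)
  | FAnd p q => FAnd (relativize g p) (relativize g q)
  | FOr p q => FOr (relativize g p) (relativize g q)
  | FEx x p => FEx x (FAnd (g x) (relativize g p))
  | FAll x p => FAll x (FOr (FNot (g x)) (relativize g p))
  | _ => phi
  end.

Lemma other_neq x : (x == other x) = false.
Proof. by rewrite /other; case: x. Qed.

Lemma sat_occurs_strictly w e b a x : sat w e (occurs_strictly b a x) =
  [exists i : 'I_(size w), (if b then i < e x else e x < i) && (nth set0 w i == a)].
Proof.
rewrite /occurs_strictly [sat _ _ _]/=; apply: eq_existsb => i; rewrite sat_letter_formula /update eqxx.
by case: b => /=; rewrite eqxx other_neq.
Qed.

Lemma sat_absent_weakly w e b a x : sat w e (absent_weakly b a x) =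
  [forall i : 'I_(size w), (if b then e x < i else i < e x) || (nth set0 w i != a)].
Proof.
rewrite /absent_weakly [sat _ _ _]/=; apply: eq_forallb => i; rewrite sat_letter_formula /update eqxx.
by case: b => /=; rewrite eqxx other_neq.
Qed.

(** Only free variables are tied to the factor [u] at offset [o]: a name not yet quantified may hold
    a position outside the factor, as does the initial valuation for a suffix. *)
Lemma sat_relativize w u o g :
  (forall i, i < size u -> nth set0 w (o + i) = nth set0 u i) ->
  o + size u <= size w ->
  (forall e x, e x < size w -> sat w e (g x) = (o <= e x < o + size u)) ->
  forall phi e e', (forall x, x \in free_vars phi -> e x < size u /\ e' x = o + e x) ->
  sat w e' (relativize g phi) = sat u e phi.
Proof.
move=> Hw Ho Hg; elim=> [||a x|b x y|p IH|p IHp q IHq|p IHp q IHq|x p IH|x p IH] e e' H //=.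
- by have [|lx ->] := H x; rewrite ?inE // Hw.
- have [|_ ->] := H x; rewrite ?inE ?eqxx //.
  have [|_ ->] := H y; rewrite ?inE ?eqxx ?orbT //.
  by case: b {H} => /=; lia.
- by rewrite (IH e).
- by rewrite (IHp e) ?(IHq e) // => z zp; apply: H; rewrite /= mem_cat zp ?orbT.
- by rewrite (IHp e) ?(IHq e) // => z zp; apply: H; rewrite /= mem_cat zp ?orbT.
- have E (i : nat) : i < size u -> sat w (update e' x (o + i)) (relativize g p) = sat u (update e x i) p.
    move=> li; apply: IH => z zp; rewrite /update; case: eqVneq => // zx.
    by apply: H; rewrite /= mem_filter zx.
  apply/existsP/existsP => -[i].
    rewrite Hg /update ?eqxx -/(update _ _ _) // => /andP [/andP [l1 l2] si].
    have li : i - o < size u by lia.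
    by exists (Ordinal li); rewrite /= -E // subnKC.
  have li : o + i < size w by have := ltn_ord i; lia.
  move=> si; exists (Ordinal li); rewrite E // si andbT Hg /update eqxx //=.
  by have := ltn_ord i; lia.
- have E (i : nat) : i < size u -> sat w (update e' x (o + i)) (relativize g p) = sat u (update e x i) p.
    move=> li; apply: IH => z zp; rewrite /update; case: eqVneq => // zx.
    by apply: H; rewrite /= mem_filter zx.
  apply/forallP/forallP => H' i.
    have li : o + i < size w by have := ltn_ord i; lia.
    rewrite -E //; have := H' (Ordinal li); rewrite Hg /update eqxx //=.
    by rewrite leq_addr ltn_add2l ltn_ord.
  rewrite Hg /update ?eqxx -/(update _ _ _) //.
  case: (boolP (o <= i < _)) => //= /andP [l1 l2].
  have li : i - o < size u by lia.
  by have := H' (Ordinal li); rewrite /= -E // subnKC.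
Qed.

Lemma free_vars_relativize g phi :
  (forall x, {subset free_vars (g x) <= [:: x]}) ->
  {subset free_vars (relativize g phi) <= free_vars phi}.
Proof.
move=> Hg; elim: phi => //= [a x|b x y|p IHp q IHq|p IHp q IHq|x p IH|x p IH] z //.
- by rewrite !mem_cat => /orP [/IHp|/IHq] ->; rewrite ?orbT.
- by rewrite !mem_cat => /orP [/IHp|/IHq] ->; rewrite ?orbT.
- rewrite !mem_filter mem_cat => /andP [zx /orP [/Hg|/IH ->]]; rewrite ?zx //.
  by rewrite inE (negbTE zx).
- rewrite !mem_filter mem_cat => /andP [zx /orP [/Hg|/IH ->]]; rewrite ?zx //.
  by rewrite inE (negbTE zx).
Qed.

Lemma var_names_relativize g phi :
  (forall x, x < 2 -> {subset var_names (g x) <= [:: 0; 1]}) ->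
  {subset var_names phi <= [:: 0; 1]} ->
  {subset var_names (relativize g phi) <= [:: 0; 1]}.
Proof.
have cons_sub x s : {subset x :: s <= [:: 0; 1]} -> x < 2 /\ {subset s <= [:: 0; 1]}.
  move=> H; split=> [|z zs]; last by apply: H; rewrite inE zs orbT.
  by have := H x; rewrite !inE eqxx => /(_ isT) /orP [] /eqP ->.
have cat_sub s t : {subset s ++ t <= [:: 0; 1]} -> {subset s <= [:: 0; 1]} /\ {subset t <= [:: 0; 1]}.
  by move=> H; split=> z zs; apply: H; rewrite mem_cat zs ?orbT.
move=> Hg; elim: phi => //= [p IHp q IHq|p IHp q IHq|x p IH|x p IH].
- case/cat_sub => /IHp Hp /IHq Hq z; rewrite mem_cat.
  by case/orP => [/Hp|/Hq].
- case/cat_sub => /IHp Hp /IHq Hq z; rewrite mem_cat.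
  by case/orP => [/Hp|/Hq].
- move=> H z; have [lx /IH Hp] := cons_sub _ _ H; rewrite inE mem_cat.
  by case/or3P => [/eqP ->|/(Hg _ lx)|/Hp] //; apply: H; rewrite inE eqxx.
- move=> H z; have [lx /IH Hp] := cons_sub _ _ H; rewrite inE mem_cat.
  by case/or3P => [/eqP ->|/(Hg _ lx)|/Hp] //; apply: H; rewrite inE eqxx.
Qed.

(** In order, the positions strictly before the first [a], after the first, before the last and
    after the last, provided that [a] occurs. *)
Definition guards a : seq (nat -> formula Sig) :=
  [:: absent_weakly true a; occurs_strictly true a; occurs_strictly false a; absent_weakly false a].

Fixpoint tests m : seq (formula Sig) :=
  if m is m'.+1 then
    tests m' ++ flatten [seq flatten [seq [seq relativize g phi | phi <- tests m']
                                     | g <- guards a] | a <- enum (letter Sig)]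
  else [seq FEx 0 (letter_formula a 0) | a <- enum (letter Sig)].

(** The names are fixed to 0 and 1, since Boolean combinations of [FO2] formulas may mix different
    pairs of names. *)
Definition two_var_sentence phi : bool :=
  sentence phi && all (fun x => x < 2) (var_names phi).

Lemma guard_names a b x :
  [/\ x < 2 -> {subset var_names (absent_weakly b a x) <= [:: 0; 1]},
      x < 2 -> {subset var_names (occurs_strictly b a x) <= [:: 0; 1]},
      {subset free_vars (absent_weakly b a x) <= [:: x]} &
      {subset free_vars (occurs_strictly b a x) <= [:: x]}].
Proof.
have name01 (y : nat) : y < 2 -> y \in [:: 0; 1] by case: y => [|[]].
have o2 : other x < 2 by rewrite /other; case: eqP.
split=> [x2|x2||] z /=.
- move=> H; apply: name01; move: H; rewrite inE mem_cat.
  case/or3P => [/eqP -> //| |/var_names_letter_formula]; last by rewrite inE => /eqP ->.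
  by case: b; rewrite !inE => /orP [] /eqP ->.
- move=> H; apply: name01; move: H; rewrite inE mem_cat.
  case/or3P => [/eqP -> //| |/var_names_letter_formula]; last by rewrite inE => /eqP ->.
  by case: b; rewrite !inE => /orP [] /eqP ->.
- rewrite mem_filter mem_cat => /andP [zo /orP [|/free_vars_letter_formula]].
    by case: b; rewrite !inE (negbTE zo) ?orbF.
  by rewrite inE (negbTE zo).
- rewrite mem_filter mem_cat => /andP [zo /orP [|/free_vars_letter_formula]].
    by case: b; rewrite !inE (negbTE zo) ?orbF.
  by rewrite inE (negbTE zo).
Qed.

Lemma two_var_sentence_relativize g phi :
  (forall x, x < 2 -> {subset var_names (g x) <= [:: 0; 1]}) ->
  (forall x, {subset free_vars (g x) <= [:: x]}) ->
  two_var_sentence phi -> two_var_sentence (relativize g phi).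
Proof.
move=> g1 g2 /andP [/eqP sp /allP vp]; apply/andP; split.
  have := free_vars_relativize (phi := phi) g2; rewrite sp /sentence.
  by case: (free_vars _) => // x s /(_ x); rewrite inE eqxx => /(_ isT).
have S : {subset var_names phi <= [:: 0; 1]} by move=> y /vp; case: y => [|[]].
by apply/allP => x /(var_names_relativize g1 S); rewrite !inE => /orP [] /eqP ->.
Qed.

Lemma two_var_sentence_tests m : all two_var_sentence (tests m).
Proof.
elim: m => [|m IH] /=.
  rewrite all_map; apply/allP => a _ /=; apply/andP; split=> /=.
    rewrite /sentence /= -size_eq0 size_filter -leqn0 leqNgt -has_count.
    by apply/hasPn => y /free_vars_letter_formula; rewrite inE negbK.
  by apply/allP => x /var_names_letter_formula; rewrite inE => /eqP ->.
rewrite all_cat IH all_flatten all_map; apply/allP => a _ /=.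
have G b x := guard_names a b x.
rewrite !all_cat !all_map andbT.
by apply/and4P; split; apply: sub_all IH => phi; apply: two_var_sentence_relativize => x;
  [have [] := G true x|have [] := G true x|have [] := G true x|have [] := G true x
  |have [] := G false x|have [] := G false x|have [] := G false x|have [] := G false x].
Qed.

Definition agree m u v := all (fun phi => models u phi == models v phi) (tests m).

Lemma agree_sym m u v : agree m u v -> agree m v u.
Proof. by apply: sub_all => phi; rewrite eq_sym. Qed.

Lemma agreeS m u v : agree m.+1 u v -> agree m u v.
Proof. by rewrite /agree /= all_cat => /andP []. Qed.

Lemma agree_mem m u v : agree m u v -> u =i v.
Proof.
elim: m => [|m IH]; last by move/agreeS.
have E w a : models w (FEx 0 (letter_formula a 0)) = (a \in w).
  rewrite /models [sat _ _ _]/=; apply/existsP/idP => [[i]|/(nthP set0) [i li wi]].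
    by rewrite sat_letter_formula /update eqxx => /eqP <-; rewrite mem_nth.
  by exists (Ordinal li); rewrite sat_letter_formula /update eqxx wi.
rewrite /agree /= all_map => /allP H a; have := H a; rewrite mem_enum => /(_ isT).
by rewrite /= !E => /eqP.
Qed.

Lemma agree_relativize m u v a u' v' i :
  agree m.+1 u v -> i < 4 ->
  (forall phi, sentence phi -> models u (relativize (nth (fun=> FTrue) (guards a) i) phi) = models u' phi) ->
  (forall phi, sentence phi -> models v (relativize (nth (fun=> FTrue) (guards a) i) phi) = models v' phi) ->
  agree m u' v'.
Proof.
rewrite /agree /= all_cat all_flatten all_map => /andP [_ /allP /(_ a)].
rewrite mem_enum => /(_ isT) /= + li Hu Hv.
rewrite !all_cat !all_map => /and5P [h0 h1 h2 h3 _].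
have T := two_var_sentence_tests m.
have sub g : (forall phi, sentence phi -> models u (relativize g phi) = models u' phi) ->
   (forall phi, sentence phi -> models v (relativize g phi) = models v' phi) ->
   all (preim (relativize g) (fun phi => models u phi == models v phi)) (tests m) ->
   all (fun phi => models u' phi == models v' phi) (tests m).
  move=> {}Hu {}Hv; elim: (tests m) T => //= phi r IH /andP [/andP [sp _] /IH {}IH] /andP [h /IH ->].
  by rewrite -Hu // -Hv // h.
by case: i li Hu Hv => [|[|[|[]]]] // _ Hu Hv; apply: (sub _ Hu Hv).
Qed.

Lemma models_relativize_prefix g u0 a u1 :
  (forall e x, e x < size (u0 ++ a :: u1) -> sat (u0 ++ a :: u1) e (g x) = (e x < size u0)) ->
  forall phi, sentence phi -> models (u0 ++ a :: u1) (relativize g phi) = models u0 phi.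
Proof.
move=> Hg phi /eqP sp; apply: (@sat_relativize _ u0 0) => [i li|||x].
- by rewrite nth_cat add0n li.
- by rewrite size_cat; lia.
- by move=> e x /Hg ->; rewrite add0n.
- by rewrite sp.
Qed.

Lemma models_relativize_suffix g u0 a u1 :
  (forall e x, e x < size (u0 ++ a :: u1) -> sat (u0 ++ a :: u1) e (g x) = (size u0 < e x)) ->
  forall phi, sentence phi -> models (u0 ++ a :: u1) (relativize g phi) = models u1 phi.
Proof.
move=> Hg phi /eqP sp; apply: (@sat_relativize _ u1 (size u0).+1) => [i li|||x].
- rewrite nth_cat; case: ltnP => [|_]; first by rewrite ltnNge addSn leqW ?leq_addr.
  by rewrite addSnnS addKn.
- by rewrite size_cat /=; lia.
- by move=> e x l; rewrite Hg //; move: l; rewrite size_cat /=; lia.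
- by rewrite sp.
Qed.

Lemma nth_first u0 a u1 i : a \notin u0 ->
  nth set0 (u0 ++ a :: u1) i == a -> i < size (u0 ++ a :: u1) -> size u0 <= i.
Proof.
move=> au0 + _; rewrite nth_cat; case: ltnP => // li /eqP ea.
by case/negP: au0; rewrite -ea mem_nth.
Qed.

Lemma nth_last_occurrence u0 a u1 i : a \notin u1 ->
  nth set0 (u0 ++ a :: u1) i == a -> i < size (u0 ++ a :: u1) -> i <= size u0.
Proof.
move=> au1; rewrite nth_cat; case: ltnP => [/ltnW //|li].
case E : (i - size u0) => [|j] /=; first by lia.
move=> /eqP ea; rewrite size_cat /= => l.
have lj : j < size u1 by move: l; rewrite -(subnKC li) E ltn_add2l ltnS.
by case/negP: au1; rewrite -ea mem_nth.
Qed.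

Lemma first_guards u0 a u1 e x : a \notin u0 ->
  e x < size (u0 ++ a :: u1) ->
  sat (u0 ++ a :: u1) e (absent_weakly true a x) = (e x < size u0) /\
  sat (u0 ++ a :: u1) e (occurs_strictly true a x) = (size u0 < e x).
Proof.
move=> au0 lx; rewrite sat_absent_weakly sat_occurs_strictly.
have l0 : size u0 < size (u0 ++ a :: u1) by rewrite size_cat /=; lia.
have n0 : nth set0 (u0 ++ a :: u1) (size u0) == a by rewrite nth_cat ltnn subnn.
split.
  apply/forallP/idP => [/(_ (Ordinal l0))|l i] /=; first by rewrite n0 orbF.
  case: (boolP (_ == a)) => [/(nth_first au0)|_]; last by rewrite orbT.
  by move=> /(_ (ltn_ord i)) l'; rewrite (leq_trans l l').
apply/existsP/idP => [[i /andP [l /(nth_first au0)/(_ (ltn_ord i))]]|l]; first by lia.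
by exists (Ordinal l0); rewrite /= l.
Qed.

Lemma last_guards u0 a u1 e x : a \notin u1 ->
  e x < size (u0 ++ a :: u1) ->
  sat (u0 ++ a :: u1) e (occurs_strictly false a x) = (e x < size u0) /\
  sat (u0 ++ a :: u1) e (absent_weakly false a x) = (size u0 < e x).
Proof.
move=> au1 lx; rewrite sat_absent_weakly sat_occurs_strictly.
have l0 : size u0 < size (u0 ++ a :: u1) by rewrite size_cat /=; lia.
have n0 : nth set0 (u0 ++ a :: u1) (size u0) == a by rewrite nth_cat ltnn subnn.
split.
  apply/existsP/idP => [[i /andP [l /(nth_last_occurrence au1)/(_ (ltn_ord i))]]|l]; first by lia.
  by exists (Ordinal l0); rewrite /= l.
apply/forallP/idP => [/(_ (Ordinal l0))|l i] /=; first by rewrite n0 orbF.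
case: (boolP (_ == a)) => [/(nth_last_occurrence au1)|_]; last by rewrite orbT.
by move=> /(_ (ltn_ord i)) l'; rewrite (leq_ltn_trans l' l).
Qed.

Lemma agree_refining : factor_refining agree.
Proof.
split=> [m u v|m u v|m u0 a u1 v0 v1 au0 av0 H]; [exact: agree_mem|exact: agreeS|].
split.
  apply: (agree_relativize (a := a) (i := 0) H) => //;
    by apply: models_relativize_prefix => e x /first_guards-/(_ ltac:(done)) [].
apply: (agree_relativize (a := a) (i := 1) H) => //;
  by apply: models_relativize_suffix => e x /first_guards-/(_ ltac:(done)) [].
Qed.

(** Reversal turns the first [a] into the last one and exchanges prefix and suffix, so guards 3 and
    2 isolate [rev u0] and [rev u1]. *)
Lemma agree_refining_rev : factor_refining (fun m u v => agree m (rev u) (rev v)).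
Proof.
split=> [m u v /agree_mem H x|m u v /agreeS //|m u0 a u1 v0 v1 au0 av0].
  by rewrite -mem_rev H mem_rev.
rewrite !rev_cat !rev_cons !cat_rcons => H.
have au0' : a \notin rev u0 by rewrite mem_rev.
have av0' : a \notin rev v0 by rewrite mem_rev.
split.
  apply: (agree_relativize (a := a) (i := 3) H) => //; apply: models_relativize_suffix => e x l.
    by have [] := last_guards au0' l.
  by have [] := last_guards av0' l.
apply: (agree_relativize (a := a) (i := 2) H) => //; apply: models_relativize_prefix => e x l.
  by have [] := last_guards au0' l.
by have [] := last_guards av0' l.
Qed.

Lemma saturated_definable (s : seq (formula Sig)) (L : language Sig) :
  all two_var_sentence s ->
  (forall u v, u != [::] -> v != [::] ->
     all (fun phi => models u phi == models v phi) s -> L u -> L v) ->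
  exists2 phi, two_var_sentence phi & defines phi L.
Proof.
elim: s L => [|psi s IH] L /=.
  move=> _ H; have [[u [un Lu]]|no] := classic (exists u, u != [::] /\ L u).
    by exists FTrue => // w wn; split=> // _; apply: H Lu.
  by exists FFalse => // w wn; split=> // Lw; case: no; exists w.
case/andP => tp ts H.
(* Words of [L] with value [b] at [psi], saturated for the remaining tests; the induction hypothesis
   applies to both values of [b]. *)
pose Lb b : language Sig := fun w => exists u,
  [/\ u != [::], L u, models u psi = b & all (fun phi => models u phi == models w phi) s].
have Lbsat b u v : u != [::] -> v != [::] ->
    all (fun phi => models u phi == models v phi) s -> Lb b u -> Lb b v.
  move=> _ _ uv [w [wn Lw wb wu]]; exists w; split=> //.
  by elim: s uv wu {IH ts H Lb} => //= phi s IH /andP [/eqP <- /IH {}IH] /andP [-> /IH].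
have [p1 t1 d1] := IH _ ts (Lbsat true); have [p2 t2 d2] := IH _ ts (Lbsat false).
exists (FOr (FAnd psi p1) (FAnd (FNot psi) p2)).
  move: tp t1 t2; rewrite /two_var_sentence /sentence /= !all_cat.
  by move=> /andP [/eqP -> ->] /andP [/eqP -> ->] /andP [/eqP -> ->].
have Lw_iff w : w != [::] -> L w <-> Lb (models w psi) w.
  move=> wn; split=> [Lw|[u [un Lu ub uw]]].
    by exists w; split=> //; elim: (s) => //= phi r ->; rewrite eqxx.
  by apply: H Lu => //; rewrite ub eqxx.
move=> w wn; rewrite Lw_iff // /models /= -!/(models _ _).
by case: (models w psi); rewrite /= ?orbF; [apply: d1|apply: d2].
Qed.

Lemma two_var_sentence_FO2 phi : two_var_sentence phi -> FO2 phi.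
Proof.
case/andP => _ /allP H; rewrite /FO2 (_ : 2 = size (iota 0 2)) //.
apply: uniq_leq_size (undup_uniq _) _ => x; rewrite mem_undup mem_iota.
exact: H.
Qed.

End Tests.

(** * Words marked with variables *)

Section MarkedWords.
Variables (A : finType) (V : finType).

Local Notation mletter := (A * {set V})%type.
Definition marked := seq mletter.
Implicit Types (M F E : marked) (u v : seq A) (Y : {set V}).

(** A list and not a set, so that [uniq (vars M)] says that no variable is placed twice. *)
Definition vars M : seq V := flatten (map (fun p : mletter => enum p.2) M).
Definition trace M : marked := [seq p : mletter <- M | p.2 != set0].
Definition erase Y M : marked := [seq (p.1, p.2 :\: Y) | p : mletter <- M].

Lemma vars_cat M1 M2 : vars (M1 ++ M2) = vars M1 ++ vars M2.
Proof. by rewrite /vars map_cat flatten_cat. Qed.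

Lemma trace_cat M1 M2 : trace (M1 ++ M2) = trace M1 ++ trace M2.
Proof. exact: filter_cat. Qed.

Lemma erase_cat Y M1 M2 : erase Y (M1 ++ M2) = erase Y M1 ++ erase Y M2.
Proof. exact: map_cat. Qed.

Lemma vars_trace M : vars (trace M) = vars M.
Proof.
elim: M => //= p M IH; rewrite /vars /= -/(vars M) -IH.
by case: eqVneq => [->|_] //=; rewrite enum_set0.
Qed.

Lemma mem_vars M x : (x \in vars M) = has (fun p : mletter => x \in p.2) M.
Proof. by elim: M => //= p M IH; rewrite /vars /= mem_cat mem_enum -/(vars M) IH. Qed.

Lemma size_trace_le M : uniq (vars M) -> size (trace M) <= #|V|.
Proof.
move=> U; have {U} : size (vars M) <= #|V| by rewrite -(card_uniqP U) max_card.
apply: leq_trans; elim: M => //= p M IH; rewrite /vars /= -/(vars M) size_cat.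
case: ifP => [pn|_] /=; last by apply: leq_trans IH (leq_addl _ _).
by rewrite -cardE -add1n leq_add // card_gt0.
Qed.

Lemma erase_unzip1 Y M : unzip1 (erase Y M) = unzip1 M.
Proof. by rewrite /unzip1 -map_comp. Qed.

Definition counterpart Y M M' :=
  forall F', erase Y F' = M' -> uniq (vars F') ->
  exists2 F, erase Y F = M & trace F = trace F'.

(* [u] simulates [v]: every placement of the variables outside [Y] in [u] can
   be copied in [v] so that every placement in [v] of the variables in [Y] has
   a counterpart in [u]. *)
Definition sigma2_le Y u v :=
  forall M, unzip1 M = u -> erase Y M = M -> uniq (vars M) ->
  exists M', [/\ unzip1 M' = v, erase Y M' = M', trace M' = trace M & counterpart Y M M'].

Lemma counterpart_refl Y M : counterpart Y M M.
Proof. by move=> F ? _; exists F. Qed.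

Lemma counterpart_cat Y M1 M1' M2 M2' :
  counterpart Y M1 M1' -> counterpart Y M2 M2' -> counterpart Y (M1 ++ M2) (M1' ++ M2').
Proof.
move=> H1 H2 F' eF' uF'.
have e1 : erase Y (take (size M1') F') = M1' by rewrite /erase map_take -/(erase Y F') eF' take_size_cat.
have e2 : erase Y (drop (size M1') F') = M2' by rewrite /erase map_drop -/(erase Y F') eF' drop_size_cat.
move: uF'; rewrite -{1}(cat_take_drop (size M1') F') vars_cat cat_uniq => /and3P [u1 _ u2].
have [F1 f1 t1] := H1 _ e1 u1; have [F2 f2 t2] := H2 _ e2 u2.
exists (F1 ++ F2); first by rewrite erase_cat f1 f2.
by rewrite trace_cat t1 t2 -trace_cat cat_take_drop.
Qed.

Lemma split_marked M u v : unzip1 M = u ++ v ->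
  exists M1 M2, [/\ M = M1 ++ M2, unzip1 M1 = u & unzip1 M2 = v].
Proof.
move=> H; exists (take (size u) M), (drop (size u) M); rewrite cat_take_drop.
by rewrite /unzip1 map_take map_drop -/(unzip1 M) H take_size_cat // drop_size_cat.
Qed.

Lemma erase_cat_id Y M1 M2 : erase Y (M1 ++ M2) = M1 ++ M2 ->
  erase Y M1 = M1 /\ erase Y M2 = M2.
Proof. by rewrite erase_cat => /eqP; rewrite eqseq_cat ?size_map // => /andP [/eqP -> /eqP ->]. Qed.

Lemma sigma2_le_cat Y c u v d : sigma2_le Y u v -> sigma2_le Y (c ++ u ++ d) (c ++ v ++ d).
Proof.
move=> H M /split_marked [C [M0 [-> <- /split_marked [U [D [-> /H uU <-]]]]]] {M0}.
case/erase_cat_id => eC /erase_cat_id [eU eD].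
rewrite !vars_cat !cat_uniq => /and3P [_ _ /and3P [uu _ _]].
have [U' [h1 h2 h3 h4]] := uU eU uu.
exists (C ++ U' ++ D); split.
- by rewrite /unzip1 !map_cat -!/(unzip1 _) h1.
- by rewrite !erase_cat eC eD h2.
- by rewrite !trace_cat h3.
by do 2 ?apply: counterpart_cat => //; apply: counterpart_refl.
Qed.

Definition unmarked u : marked := [seq (a, set0) | a <- u].

Lemma unzip1_unmarked u : unzip1 (unmarked u) = u.
Proof. by rewrite /unzip1 -map_comp map_id_in. Qed.

Lemma erase_unmarked Y u : erase Y (unmarked u) = unmarked u.
Proof. by rewrite /erase -map_comp; apply: eq_map => a /=; rewrite set0D. Qed.

Lemma trace_unmarked u : trace (unmarked u) = [::].
Proof. by elim: u => //= a u IH; rewrite eqxx. Qed.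

Lemma unmarked_cat u v : unmarked (u ++ v) = unmarked u ++ unmarked v.
Proof. exact: map_cat. Qed.

Lemma vars_nil_unmarked M : vars M = [::] -> M = unmarked (unzip1 M).
Proof.
elim: M => //= -[a s] M IH; rewrite /vars /= -/(vars M) => /eqP.
rewrite -size_eq0 size_cat addn_eq0 !size_eq0 => /andP [/eqP s0 /eqP /IH <-].
congr ((_, _) :: _); apply/setP => x; rewrite inE -mem_enum s0 //.
Qed.

(* One copy of [u] per marked letter is enough to realize any trace over the
   letters of [u]. *)
Lemma realize_trace Y u (t : marked) n :
  size t <= n -> (forall p, p \in t -> [/\ p.1 \in u, p.2 != set0 & p.2 \subset Y]) ->
  exists2 F, erase Y F = unmarked (power u n) & trace F = t.
Proof.
elim: n t => [|n IH] [|[a s] t] //=.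
- by exists [::].
- by move=> _ _; exists (unmarked (power u n.+1)); rewrite ?erase_unmarked ?trace_unmarked.
rewrite ltnS => st H; have [|F f1 f2] := IH t st.
  by move=> p pt; apply: H; rewrite inE pt orbT.
have [|/= au sn sY] := H (a, s); first by rewrite inE eqxx.
have sY0 : s :\: Y = set0 by apply/eqP; rewrite setD_eq0.
have [u0 [u1 [def_u _]]] := first_occurrence au.
exists (unmarked u0 ++ [:: (a, s)] ++ unmarked u1 ++ F).
  rewrite -[n.+1]add1n powerD power1 unmarked_cat -f1 {1}def_u -cat1s.
  by rewrite !unmarked_cat !erase_cat !erase_unmarked /erase /= sY0 -catA.
by rewrite !trace_cat !trace_unmarked f2 /= sn.
Qed.

(** Pigeonhole: at most [n] placed variables cannot touch all of the [n.+1] copies of [u]. *)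
Lemma free_block u M n :
  unzip1 M = power u n.+1 -> size (vars M) <= n ->
  exists i j M1 M2, [/\ i + j = n, M = M1 ++ unmarked u ++ M2,
    unzip1 M1 = power u i & unzip1 M2 = power u j].
Proof.
elim: n M => [|n IH] M eM sM.
  exists 0, 0, [::], [::]; split=> //; rewrite cats0 /=.
  have := vars_nil_unmarked (M := M); rewrite eM power1; apply.
  by apply/eqP; rewrite -size_eq0 -leqn0.
have [M1 [M2 [def_M e1 e2]]] := split_marked (u := u) (v := power u n.+1) eM.
move: sM; rewrite def_M vars_cat size_cat.
have [/eqP|s1] := posnP (size (vars M1)).
  rewrite size_eq0 => /eqP /vars_nil_unmarked; rewrite e1 => def1 _.
  by exists 0, n.+1, [::], M2; rewrite -def1.
move=> s12; have [|i [j [N1 [N2 [ij -> f1 f2]]]]] := IH M2 e2; first by lia.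
exists i.+1, j, (M1 ++ N1), N2; split; rewrite ?catA ?addSn ?ij //.
by rewrite /unzip1 map_cat -!/(unzip1 _) e1 f1.
Qed.

(** View [power u N] as [#|V|.+1] copies of [W]. One copy carries no variable, and the extra
    material is inserted there. Whatever is then placed on it has a trace of at most [#|V|] letters
    of [u], which is realized inside the single copy [W]. *)
Lemma sigma2_le_power Y u x (N := #|V| * #|V|.+1) :
  {subset x <= u} -> sigma2_le Y (power u N) (power u N ++ x ++ power u N).
Proof.
move=> sub; rewrite /N -powerM; set W := power u #|V|; set n := #|V|.
move=> M eM EM uM.
have sM : size (vars M) <= n by rewrite -(card_uniqP uM) max_card.
have [i [j [M1 [M2 [ij def_M e1 e2]]]]] := free_block eM sM.
(* The exponents complete the surrounding [i] and [j] copies, where [i + j = n], to [n.+1] on each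
   side of [x]. *)
pose z := power W j.+1 ++ x ++ power W i.+1.
exists (M1 ++ unmarked z ++ M2); split.
- rewrite /unzip1 !map_cat -!/(unzip1 _) e1 e2 unzip1_unmarked /z.
  have d1 : power W n.+1 = power W i ++ power W j.+1 by rewrite -powerD addnS ij.
  have d2 : power W n.+1 = power W i.+1 ++ power W j by rewrite -powerD addSn ij.
  by rewrite {1}d1 d2 -!catA.
- move: EM; rewrite def_M => /erase_cat_id [E1 /erase_cat_id [_ E2]].
  by rewrite !erase_cat E1 E2 erase_unmarked.
- by rewrite def_M !trace_cat !trace_unmarked.
rewrite def_M; apply: counterpart_cat; first exact: counterpart_refl.
apply: counterpart_cat; last exact: counterpart_refl.
move=> F eF uF; apply: realize_trace (size_trace_le uF) _ => p.
rewrite mem_filter => /andP [pn pF]; split=> //.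
  have : p.1 \in z.
    by rewrite -(unzip1_unmarked z) -eF erase_unzip1; apply: map_f.
  have subW k : {subset power W k <= u} by move=> y /mem_power /mem_power.
  rewrite /z; move: (subW j.+1) (subW i.+1).
  move: (power W j.+1) (power W i.+1) => P1 P2 s1 s2.
  by rewrite !mem_cat => /or3P [/s1|/sub|/s2].
have : (p.1, p.2 :\: Y) \in unmarked z by rewrite -eF; apply/mapP; exists p.
by case/mapP => a _ [_ /eqP]; rewrite setD_eq0.
Qed.

Local Notation btrace := (#|V|.-bseq mletter).

(** A finite invariant: the trace of each placement of the variables outside [Y], with the set of
    traces of its extensions by variables in [Y]. Traces have length at most [#|V|], a variable
    being placed at most once. *)
Definition sigma2_type Y u : {set btrace * {set btrace}} :=
  [set ts : btrace * {set btrace} | [exists M : (size u).-tuple mletter,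
    [&& unzip1 M == u, erase Y M == M, uniq (vars M), trace M == ts.1 &
        ts.2 == [set t : btrace | [exists F : (size u).-tuple mletter,
                   [&& erase Y F == M, uniq (vars F) & trace F == t]]]]]].

Lemma sigma2_type_le Y u v : sigma2_type Y u = sigma2_type Y v -> sigma2_le Y u v.
Proof.
move=> Ht M eM EM uM.
have sz : size M == size u by rewrite -eM size_map.
pose t : btrace := Bseq (size_trace_le uM).
pose S := [set t : btrace |
  [exists F : (size u).-tuple mletter,
     [&& erase Y F == M, uniq (vars F) & trace F == t]]].
have : (t, S) \in sigma2_type Y u.
  by rewrite inE; apply/existsP; exists (Tuple sz); rewrite /= eM EM uM !eqxx.
rewrite Ht inE => /existsP [M' /and5P [/eqP e1 /eqP e2 u' /eqP t' /eqP /= S']].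
exists M'; split=> // F eF uF.
have szF : size F == size v by rewrite -(size_tuple M') -eF size_map.
have : Bseq (size_trace_le uF) \in S.
  by rewrite S' inE; apply/existsP; exists (Tuple szF); rewrite /= eF uF !eqxx.
rewrite inE => /existsP [F' /and3P [/eqP f1 _ /eqP f2]].
by exists F'.
Qed.

End MarkedWords.

(** * Evaluating formulas on marked words *)

Section MarkSat.
Variables (Sig : finType) (K : nat).
Local Notation V := 'I_K.+1.
Implicit Types (M F : marked (letter Sig) V) (w u v : word Sig) (D Y : {set V}) (e : nat -> nat).
Implicit Types (psi : formula Sig).

Definition mark D w e : marked (letter Sig) V :=
  [seq (nth set0 w i, [set x in D | e (val x) == i]) | i <- iota 0 (size w)].

Lemma unzip1_mark D w e : unzip1 (mark D w e) = w.
Proof. by rewrite /unzip1 -map_comp -/(mkseq _ _) mkseq_nth. Qed.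

Lemma erase_mark Y D w e : erase Y (mark D w e) = mark (D :\: Y) w e.
Proof.
rewrite /erase -map_comp; apply: eq_map => i /=; congr (_, _).
by apply/setP => x; rewrite !inE -andbA.
Qed.

Lemma eq_mark D w e e' :
  (forall x, x \in D -> e (val x) = e' (val x)) -> mark D w e = mark D w e'.
Proof.
move=> H; apply: eq_map => i; congr (_, _); apply/setP => x; rewrite !inE.
by case: (boolP (x \in D)) => // /H ->.
Qed.

Lemma mark_inj D w e e' x :
  mark D w e = mark D w e' -> x \in D -> e (val x) < size w -> e (val x) = e' (val x).
Proof.
move=> H xD lx; have /(congr1 (fun M => nth (set0, set0) M (e (val x)))) := H.
rewrite !(nth_map 0) ?size_iota // nth_iota // add0n => -[/setP /(_ x)].
by rewrite !inE xD eqxx => /esym /eqP ->.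
Qed.

Lemma vars_mark D w e : in_range w e ->
  uniq (vars (mark D w e)) /\ vars (mark D w e) =i D.
Proof.
move=> er; split; last first.
  move=> x; rewrite mem_vars has_map; apply/hasP/idP => [[i _]|xD] /=.
    by rewrite !inE => /andP [].
  by exists (e (val x)); rewrite ?mem_iota ?add0n //= ?inE ?xD ?eqxx ?er.
rewrite /mark; elim: (size w) (0) => // n IH m; rewrite /vars /= -/(vars _).
rewrite cat_uniq enum_uniq IH andbT /=; apply/hasPn => x.
rewrite mem_vars has_map => /hasP [i]; rewrite mem_iota /= !inE => /andP [l _] /andP [_ /eqP ei].
by rewrite mem_enum !inE ei eqn_leq [i <= m]leqNgt l andbF.
Qed.

Lemma find_var M x i : uniq (vars M) -> i < size M ->
  x \in (nth (set0, set0) M i).2 -> find (fun p : letter Sig * {set V} => x \in p.2) M = i.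
Proof.
elim: M i => // p M IH i; rewrite /vars /= -/(vars M) cat_uniq => /and3P [_ /hasPn H uM].
case: i => [_ /= -> //|i] /=; rewrite ltnS => li xi.
have xM : x \in vars M by rewrite mem_vars; apply/(has_nthP (set0, set0)); exists i.
by have := H _ xM; rewrite /= mem_enum => /negbTE ->; rewrite (IH i).
Qed.

(** The valuation reads off where each variable is placed; variables not placed get position 0,
    which is in range because [M] is nonempty. *)
Lemma marked_mark D M : M != [::] -> uniq (vars M) -> vars M =i D ->
  exists2 e, in_range (unzip1 M) e & M = mark D (unzip1 M) e.
Proof.
move=> Mn uM vM.
pose P (x : V) := fun p : letter Sig * {set V} => x \in p.2.
exists (fun n => if has (P (inord n)) M then find (P (inord n)) M else 0).
  move=> n; rewrite size_map; case: ifP; first by rewrite has_find.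
  by case: (M) Mn.
apply: (@eq_from_nth _ (set0, set0)) => [|i li]; first by rewrite size_map size_iota size_map.
rewrite (nth_map 0) ?size_iota ?size_map // nth_iota ?size_map // add0n.
rewrite (nth_map (set0, set0)) // [LHS]surjective_pairing; congr (_, _).
apply/setP => x; rewrite !inE inord_val -vM mem_vars -/(P x).
apply/idP/idP => [xi|/andP [h]]; last first.
  by rewrite h => /eqP <-; apply: (nth_find (set0, set0) h).
have -> : has (P x) M by apply/(has_nthP (set0, set0)); exists i.
by rewrite (find_var uM li xi) eqxx.
Qed.

(** Defined without indices, so that deleting unmarked letters does not change it. *)
Fixpoint mark_lt M (x y : V) : bool :=
  if M is p :: M' then
    (x \in p.2) && has (fun q : letter Sig * {set V} => y \in q.2) M' || mark_lt M' x y
  else false.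

(* Only meaningful when every variable of [psi] is placed in [M]. *)
Fixpoint marked_sat M psi : bool :=
  match psi with
  | FTrue => true
  | FLetter a x => has (fun p : letter Sig * {set V} => (a \in p.1) && (inord x \in p.2)) M
  | FBin BLt x y => mark_lt M (inord x) (inord y)
  | FBin BLe x y => ~~ mark_lt M (inord y) (inord x)
  | FBin BEq x y => ~~ mark_lt M (inord x) (inord y) && ~~ mark_lt M (inord y) (inord x)
  | FBin BNe x y => mark_lt M (inord x) (inord y) || mark_lt M (inord y) (inord x)
  | FNot p => ~~ marked_sat M p
  | FAnd p q => marked_sat M p && marked_sat M q
  | FOr p q => marked_sat M p || marked_sat M q
  | _ => false
  end.

Lemma mark_lt_trace M x y : mark_lt (trace M) x y = mark_lt M x y.
Proof.
elim: M => //= p M IH; have H z : has (fun q : letter Sig * {set V} => z \in q.2) (trace M) =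
    has (fun q : letter Sig * {set V} => z \in q.2) M by rewrite -!mem_vars vars_trace.
by case: eqVneq => [->|_] /=; rewrite IH ?H // inE.
Qed.

Lemma marked_sat_trace M psi : marked_sat (trace M) psi = marked_sat M psi.
Proof.
elim: psi => //= [a x|[] x y|p ->|p -> q ->|p -> q ->] //; rewrite ?mark_lt_trace //.
elim: M => //= p M IH; case: eqVneq => [p0|_] /=; rewrite IH // p0 inE andbF //.
Qed.

Lemma mark_lt_mark w e x y : in_range w e ->
  mark_lt (mark setT w e) x y = (e (val x) < e (val y)).
Proof.
move=> er; have E n m : mark_lt [seq (nth set0 w i, [set x in setT | e (val x) == i])
    | i <- iota m n] x y = [&& m <= e (val x), e (val x) < e (val y) & e (val y) < m + n].
  elim: n m => [|n IH] m /=; first by lia.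
  rewrite IH !inE has_map.
  have -> : has (preim (fun i => (nth set0 w i, [set x in setT | e (val x) == i]))
      (fun q : letter Sig * {set V} => y \in q.2)) (iota m.+1 n) = (m < e (val y) < m.+1 + n).
    apply/hasP/idP => [[i]|l]; first by rewrite mem_iota /= !inE => + /= /eqP ->.
    by exists (e (val y)); rewrite ?mem_iota //= !inE eqxx.
  move: (e (val x)) (e (val y)) => a b; lia.
by rewrite E /= er andbT.
Qed.

Lemma sat_mark w e psi : in_range w e -> quantifier_free psi ->
  {in var_names psi, forall x, x <= K} ->
  sat w e psi = marked_sat (mark setT w e) psi.
Proof.
move=> er; elim: psi => //= [a x|b x y|p IH|p IHp q IHq|p IHp q IHq].
- move=> _ H; have xK : x <= K by apply: H; rewrite inE.
  rewrite has_map; apply/idP/hasP => [h|[i _ /= /andP [h]]].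
    by exists (e x); rewrite ?mem_iota ?er //= h !inE inordK ?eqxx.
  by rewrite !inE inordK // => /eqP ->.
- move=> _ H; have xK : x <= K by apply: H; rewrite inE eqxx.
  have yK : y <= K by apply: H; rewrite !inE eqxx orbT.
  by case: b; rewrite /= ?mark_lt_mark //= !inordK //; lia.
- by move=> qf H; rewrite IH.
- by move=> /andP [qp qq] H; rewrite IHp ?IHq // => z zp; apply: H; rewrite mem_cat zp ?orbT.
- by move=> /andP [qp qq] H; rewrite IHp ?IHq // => z zp; apply: H; rewrite mem_cat zp ?orbT.
Qed.

(** The existential witnesses in [u] are copied to [v] as a placement outside [Y]. Every universal
    choice in [v] then has a counterpart in [u] with the same trace, and the trace decides [psi]. *)
Lemma sigma2_le_models xs ys psi u v (Y : {set V} := [set x : V | val x \in ys]) :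
  quantifier_free psi -> {in var_names psi, forall x, x <= K} ->
  sentence (FExs xs (FAlls ys psi)) -> u != [::] -> v != [::] ->
  sigma2_le Y u v ->
  models u (FExs xs (FAlls ys psi)) -> models v (FExs xs (FAlls ys psi)).
Proof.
move=> qf names sent un vn uv; rewrite !models_prenex // => -[e er He].
have [uM vM] := vars_mark (~: Y) er.
have EM : erase Y (mark (~: Y) u e) = mark (~: Y) u e.
  by rewrite erase_mark setDE setIid.
have [M' [e1 E1 t1 cp]] := uv _ (unzip1_mark _ _ _) EM uM.
have vM' : vars M' = vars (mark (~: Y) u e) by rewrite -vars_trace t1 vars_trace.
have M'n : M' != [::] by rewrite -size_eq0 -(size_map fst) -/(unzip1 M') e1 size_eq0.
have [||f fr def_M'] := @marked_mark (~: Y) M' M'n; rewrite ?vM' //.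
rewrite e1 in fr def_M'.
exists f => // f2 fr2 ff2.
have F'E : erase Y (mark setT v f2) = M'.
  rewrite erase_mark setTD def_M'; apply: eq_mark => x; rewrite !inE => xY.
  exact: ff2.
have [uF' vF'] := vars_mark setT fr2.
have [F eF tF] := cp _ F'E uF'.
have vF : vars F = vars (mark setT v f2) by rewrite -vars_trace tF vars_trace.
have F1 : unzip1 F = u by rewrite -(erase_unzip1 Y) eF unzip1_mark.
have Fn : F != [::] by rewrite -size_eq0 -(size_map fst) -/(unzip1 F) F1 size_eq0.
have [||e3 er3 def_F] := @marked_mark setT F Fn; rewrite ?vF //.
rewrite F1 in er3 def_F.
(* Marks say nothing about names above [K]; there the valuation must be that of the witness [e]. *)
pose e4 x := if x <= K then e3 x else e x.
have er4 : in_range u e4 by move=> x; rewrite /e4; case: ifP.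
have def_F4 : F = mark setT u e4.
  rewrite def_F; apply: eq_mark => x _; rewrite /e4 ifT //; exact: (ltn_ord x).
rewrite (sat_mark fr2 qf names) -marked_sat_trace -tF marked_sat_trace def_F4.
rewrite -(sat_mark er4 qf names); apply: He => // x xys; rewrite /e4.
case: leqP => // xK; have xE : x = val (inord x : V) by rewrite /= inordK.
rewrite [LHS]/= xE; apply: (@mark_inj (~: Y) u) => //; last by rewrite !inE -xE.
by rewrite -eF def_F erase_mark setTD.
Qed.

End MarkSat.

(** * The syntactic congruence of a language that is Sigma2 and co-Sigma2 *)

Section Delta2.
Variables (Sig : finType) (L : language Sig).

Lemma leq_sumn (s : seq nat) x : x \in s -> x <= sumn s.
Proof.
elim: s => //= y s IH; rewrite inE => /orP [/eqP ->|/IH]; first exact: leq_addr.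
by move/leq_trans; apply; apply: leq_addl.
Qed.

(** [defines] leaves membership of the empty word open, so it is removed before taking the syntactic
    congruence. *)
Definition nonempty_part (w : word Sig) := w != [::] /\ L w.

Definition syntactic (u v : word Sig) :=
  forall c d, nonempty_part (c ++ u ++ d) <-> nonempty_part (c ++ v ++ d).

Lemma Delta2_DA (phi1 phi2 : formula Sig) :
  Sigma2 phi1 -> sentence phi1 -> defines phi1 L ->
  Sigma2 phi2 -> sentence phi2 -> defines phi2 (fun w => ~ L w) ->
  exists (T : finType) N (tau : word Sig -> T), DA_congruence N syntactic tau.
Proof.
move=> [xs1 [ys1 [psi1 [qf1 ->]]]] s1 d1 [xs2 [ys2 [psi2 [qf2 ->]]]] s2 d2.
pose K := sumn (var_names psi1 ++ var_names psi2).
have n1 : {in var_names psi1, forall x, x <= K}.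
  by move=> x xp; apply: leq_sumn; rewrite mem_cat xp.
have n2 : {in var_names psi2, forall x, x <= K}.
  by move=> x xp; apply: leq_sumn; rewrite mem_cat xp orbT.
pose Y1 := [set x : 'I_K.+1 | val x \in ys1].
pose Y2 := [set x : 'I_K.+1 | val x \in ys2].
(* Simulation of [u] by [v] suffices for both directions: through the first formula it preserves
   membership in [L], through the second it preserves non-membership. *)
have synt u v : (u == [::]) = (v == [::]) -> sigma2_le Y1 u v -> sigma2_le Y2 u v -> syntactic u v.
  move=> uv le1 le2 c d.
  have uvn : (c ++ u ++ d == [::]) = (c ++ v ++ d == [::]).
    by case: c => //=; case: u v uv {le1 le2} => [|a u] [|b v].
  split=> -[wn Lw]; have wn' := wn; first rewrite uvn in wn'; last rewrite -uvn in wn'.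
    split=> //; apply/(d1 _ wn'); move/(d1 _ wn): Lw.
    by apply: (@sigma2_le_models Sig K) => //; apply: sigma2_le_cat.
  split=> //; apply: NNPP => /(d2 _ wn') nL.
  have /(d2 _ wn) : models (c ++ v ++ d) (FExs xs2 (FAlls ys2 psi2)); last by case.
  move: nL; apply: (@sigma2_le_models Sig K) => //; exact: sigma2_le_cat.
exists _, (#|'I_K.+1| * #|'I_K.+1|.+1),
  (fun u => (u == [::], sigma2_type Y1 u, sigma2_type Y2 u)); split.
- by move=> u c d.
- by move=> u v H c d; split=> /H.
- by move=> u v w H1 H2 c d; rewrite H1.
split.
- by move=> c u v d H c' d'; have := H (c' ++ c) (d ++ d'); rewrite -!catA.
- by move=> u v [uv t1 t2]; apply: synt => //; apply: sigma2_type_le.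
move=> u x sub; apply: synt; try exact: sigma2_le_power.
(* The exponent is positive, so both words are nonempty unless [u], and with it [x], is empty. *)
case: (u) sub => [|a u'] sub; last by rewrite card_ord.
have -> : x = [::] by case: x sub => // b x /(_ b); rewrite !inE eqxx => /(_ isT).
have P0 n : power [::] n = [::] :> word Sig by elim: n => //= n IH; rewrite powerSr IH.
by rewrite !P0.
Qed.

Theorem Delta2_FO2 :
  definable_in (@Sigma2_pos Sig) L -> definable_in (@Pi2_pos Sig) L ->
  definable_in (@FO2 Sig) L.
Proof.
move=> [phi1 [[S1 _] s1 d1]] [phi2 [[P2 _] s2 d2]].
have S2 : Sigma2 (neg phi2).
  have [xs [ys [psi [qf ->]]]] := P2; exists xs, ys, (neg psi).
  by rewrite neg_FAlls neg_FExs; split=> //; apply: quantifier_free_neg.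
have d2' : defines (neg phi2) (fun w => ~ L w).
  move=> w wn; rewrite /models sat_neg -/(models w phi2); split=> [nL|/negP h /(d2 _ wn) //].
  by apply/negP => /(d2 _ wn).
have s2' : sentence (neg phi2) by rewrite sentence_neg.
have [T [N [tau da]]] := Delta2_DA S1 s1 d1 S2 s2' d2'.
(* No word has more than [#|letter Sig|] distinct letters, so one level of tests serves all
   words. *)
have [m Hm] := DA_factor_refining da (@agree_refining Sig) (@agree_refining_rev Sig)
  (@agree_sym Sig) #|letter Sig|.
have [u v un vn uv Lu|phi tp dp] := @saturated_definable Sig (tests Sig m) L (two_var_sentence_tests _ m).
  have su : size (undup u) <= #|letter Sig| by rewrite -(card_uniqP (undup_uniq u)) max_card.
  by have := Hm u v su uv [::] [::]; rewrite /= !cats0 => -[[]].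
by exists phi; split=> //; [apply: two_var_sentence_FO2|case/andP: tp].
Qed.

Lemma Sigma2_pos_monotone : definable_in (@Sigma2_pos Sig) L -> monotone L.
Proof.
move=> [phi [[_ nf] _ d]] u v Lu uv; have /word_leP [suv _] := uv.
(* The empty word is invisible to the formula but comparable only to itself. *)
have [u0|un] := eqVneq u [::].
  by have -> : v = u by move: suv; rewrite u0; case: v {uv}.
have vn : v != [::] by rewrite -size_eq0 -suv size_eq0.
by apply/(d v vn); apply: sat_monotone nf uv _; apply/(d u un).
Qed.

End Delta2.

Theorem theorem36 (Sig : finType) (L : language Sig) :
  definable_in (@Sigma2_pos Sig) L /\ definable_in (@Pi2_pos Sig) L <->
  monotone L /\ definable_in (@FO2 Sig) L.
Proof.
split=> [[S P]|[mon fo2]].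
  by split; [apply: Sigma2_pos_monotone|apply: Delta2_FO2].
by split; [apply: monotone_FO2_Sigma2_pos|apply: monotone_FO2_Pi2_pos].
Qed.
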